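(* Let $1\le k\le n$ and let $A_1,\ldots,A_k$ be generic real symmetric $n\times n$ matrices; put $B_i=A_i-A_{i+1}$ for $i=1,\ldots,k-1$ and $B_k=A_k$. The degree (number of complex critical points) of the heterogeneous quadratics minimization problem over the flag variety, $$\min\ \sum_{i=1}^k\operatorname{trace}(B_iP_i)\quad\text{subject to }(P_1,\ldots,P_k)\in\mathrm{pFl}(1,2,\ldots,k;n),$$ is equal to the LO degree of $\mathrm{pFl}(1,2,\ldots,k;n)$. Therefore, both this problem and the problem $$\min_{Z^TZ=\mathrm{Id}_k}\ \sum_{i=1}^kZ_i^TA_iZ_i$$ (where $Z=[Z_1\cdots Z_k]$ is an $n\times k$ matrix of variables) have finitely many complex critical points.
   Context: $\mathrm{pFl}(1,2,\ldots,k;n)$ is the smooth affine variety of tuples $(P_1,\ldots,P_k)$ of complex symmetric $n\times n$ matrices with $P_iP_j=P_j$ and $\operatorname{trace}(P_i)=i$ for $1\le j\le i\le k$, embedded in the affine space $\mathrm{Sym}(\mathbb{C}^n)^k$. The linear optimization degree (LO degree) of an affine variety is the number of complex critical points of a generic linear form on the variety. A critical point of a function $f$ on a smooth affine variety $W$ is a point $p\in W$ at which the differential of $f$ vanishes on $T_pW$; for the second problem, $W=\{Z\in\mathbb{C}^{n\times k}:Z^TZ=\mathrm{Id}_k\}$. ''Generic'' means outside some proper Zariski closed subset of the parameter space. *)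

(* Defs.v *)
From HB Require Import structures.
From mathcomp Require Import all_boot all_order all_algebra.
From mathcomp Require Import mpoly complex.
From mathcomp Require Import boolp classical_sets cardinality reals.

Set Implicit Arguments.
Unset Strict Implicit.
Unset Printing Implicit Defensive.

Import Order.TTheory GRing.Theory Num.Theory.

Local Open Scope ring_scope.
Local Open Scope complex_scope.
Local Open Scope classical_set_scope.
Local Open Scope card_scope.

Section AffineGeometry.
Context {K : fieldType}.

(* Value at [x] of the polynomial [F], read in the coordinates of [E] with
   respect to the basis [vbasis {:E}]. *)
Definition peval {E : vectType K} (F : {mpoly K[\dim {:E}]}) (x : E) : K :=
  F.@[fun i => coord (vbasis {:E}) i x].

(* The differential of [F] at [p], applied to [v]. *)
Definition pdiff {E : vectType K} (F : {mpoly K[\dim {:E}]}) (p v : E) : K :=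
  \sum_(i < \dim {:E}) peval F^`M(i) p * coord (vbasis {:E}) i v.

Definition zariski_closed {E : vectType K} (Z : set E) : Prop :=
  exists I : set {mpoly K[\dim {:E}]},
    Z = [set x | forall F, I F -> peval F x = 0].

Definition generic {E : vectType K} (P : set E) : Prop :=
  exists Z : set E, [/\ zariski_closed Z, Z <> setT & ~` Z `<=` P].

(* T_p W is cut out by the differentials of all polynomials vanishing on W. *)
Definition tangent {E : vectType K} (W : set E) (p : E) : set E :=
  [set v | forall F : {mpoly K[\dim {:E}]},
     (forall x, W x -> peval F x = 0) -> pdiff F p v = 0].

(* Critical points on W of a polynomial function f on E.  Over an infinite
   field, the only one used here, the polynomial F is determined by f. *)
Definition critical {E : vectType K} (W : set E) (f : E -> K) : set E :=
  [set p | W p /\ exists2 F : {mpoly K[\dim {:E}]},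
     (forall x, peval F x = f x) &
     (forall v, tangent W p v -> pdiff F p v = 0)].

Definition LO_degree {E : vectType K} (W : set E) (d : nat) : Prop :=
  generic [set l : 'Hom(E, K^o) | critical W l #= `I_d].

End AffineGeometry.

Definition Sym (K : fieldType) (n : nat) : vectType K :=
  subvs_of (fixedSpace (linfun (@trmx K n n))).

Definition symmx {K : fieldType} {n : nat} (A : Sym K n) : 'M[K]_n := vsval A.

(* The index i : 'I_k stands for the index i + 1 of the informal notation. *)
Definition pFl (K : fieldType) (k n : nat) : set {ffun 'I_k -> Sym K n} :=
  [set P | (forall i j : 'I_k, (j <= i)%N ->
              symmx (P i) *m symmx (P j) = symmx (P j)) /\
           (forall i : 'I_k, \tr (symmx (P i)) = i.+1%:R)].

Definition stiefel (K : fieldType) (k n : nat) : set 'M[K]_(n, k) :=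
  [set Z | Z^T *m Z = 1%:M].

(* B_i = A_i - A_(i+1) for i < k and B_k = A_k. *)
Definition consecutive_diff {V : zmodType} {k : nat} (A : 'I_k -> V)
    (i : 'I_k) : V :=
  if insub i.+1 is Some j then A i - A j else A i.

Definition cplxmx {R : realType} {n : nat} (A : Sym R n) : 'M[R[i]]_n :=
  map_mx (real_complex R) (symmx A).

Definition flag_objective {R : realType} {k n : nat} (B : 'I_k -> Sym R n)
    (P : {ffun 'I_k -> Sym R[i] n}) : R[i] :=
  \sum_i \tr (cplxmx (B i) *m symmx (P i)).

Definition stiefel_objective {R : realType} {k n : nat} (A : 'I_k -> Sym R n)
    (Z : 'M[R[i]]_(n, k)) : R[i] :=
  \sum_i ((col i Z)^T *m cplxmx (A i) *m col i Z) 0 0.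

(* Main.v *)
Require Import Defs.
From HB Require Import structures.
From mathcomp Require Import all_boot all_order all_algebra.
From mathcomp Require Import mpoly complex.
From mathcomp Require Import boolp classical_sets cardinality reals.
From mathcomp Require Import ring zify closed_field.

(** Write [E] for the space of [k]-tuples of symmetric matrices.  A linear form
    on [E] is a trace form [P |-> \sum tr (B_i P_i)], so both problems on the
    flag variety ask for the critical points of such a form, with [B] either a
    generic complex tuple or the tuple of differences of generic real matrices.

    Critical points.  The orthogonal group acts transitively on the flag
    variety, and the velocities [[W, P_i]] with [W] skew are tangent because
    they come from rational curves (Cayley transforms).  Together with the
    derivatives of [P_i P_j = P_j] this shows that [P] is critical exactly when
    [\sum [B_i, P_i] = 0] ([critical_pFl]).  Summation by parts turns this
    equation into [\sum [A_j, z_j z_j^T] = 0] for a frame [Z] of the flag, which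
    is the critical equation on the Stiefel manifold ([critical_stiefel]).

    Finiteness.  The pairs [(B, P)] with [P] critical for [B] are covered by a
    rational map defined on [E] itself ([chart_cover]): a flag with its
    orthogonal frame has a Cayley parameter, and after rotation to the standard
    flag the equation is linear in [B] and determines exactly as many entries of
    [B] as the Cayley parameter has.  Since [dim E + 1] rational functions on
    [E] are algebraically dependent ([algebraic_dependence]), each coordinate of
    [P] is a root of a polynomial whose coefficients are polynomials in [B], and
    for generic [B] this polynomial is nonzero.  This bounds the number of
    critical points for generic [B] ([generic_bounded]).

    Constancy.  Having at least [d] critical points is a first-order condition
    on [B].  By quantifier elimination over an algebraically closed field it is
    a Boolean combination of polynomial equations, so it holds generically or
    fails generically.  With the bound this yields a number [d] of critical
    points that is attained generically ([generic_card]).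

    Both problems.  The open set of good [B] pulls back to the space of linear
    forms and, since real points are Zariski dense, to real tuples [A]
    ([generic_real]): the same [d] serves for both.  A frame is determined by
    its flag up to signs, so the Stiefel problem has finitely many critical
    points as well. *)

Set Implicit Arguments.
Unset Strict Implicit.
Unset Printing Implicit Defensive.

Import Order.TTheory GRing.Theory Num.Theory.

Local Open Scope ring_scope.
Local Open Scope complex_scope.
Local Open Scope classical_set_scope.
Local Open Scope card_scope.

(** * Polynomial functions on a vector space *)

Section PolynomialFunctions.
Context {K : fieldType}.

Lemma mpoly_ring_ind n (Q : {mpoly K[n]} -> Prop) :
    (forall c, Q c%:MP) -> (forall i, Q 'X_i) ->
    (forall F G, Q F -> Q G -> Q (F + G)) ->
    (forall F G, Q F -> Q G -> Q (F * G)) ->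
  forall F, Q F.
Proof.
move=> QC QX QD QM F; elim/mpolyind: F => [|c m F _ _ QF]; first exact: QC 0.
apply: QD => //; rewrite -mul_mpolyC mpolyXE_id; apply: (QM) => //.
elim/big_ind: _ => [|G H|i _]; [exact: QC 1|exact: QM|].
elim: (m i) => [|e IH]; first exact: QC 1.
by rewrite exprS; apply: QM.
Qed.

Context {E : vectType K}.
Implicit Types (f g : E -> K) (F G : {mpoly K[\dim {:E}]}) (x v p : E).

Lemma pevalC c x : peval c%:MP x = c. Proof. exact: mevalC. Qed.
Lemma pevalX i x : peval 'X_i x = coord (vbasis {:E}) i x.
Proof. exact: mevalXU. Qed.
Lemma pevalD F G x : peval (F + G) x = peval F x + peval G x.
Proof. exact: mevalD. Qed.
Lemma pevalB F G x : peval (F - G) x = peval F x - peval G x.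
Proof. exact: mevalB. Qed.
Lemma pevalM F G x : peval (F * G) x = peval F x * peval G x.
Proof. exact: mevalM. Qed.

Lemma pdiffC c p v : pdiff c%:MP p v = 0.
Proof. by rewrite /pdiff big1 // => i _; rewrite mderivC /peval meval0 mul0r. Qed.
Lemma pdiffX i p v : pdiff 'X_i p v = coord (vbasis {:E}) i v.
Proof.
rewrite /pdiff (bigD1 i) //= big1 ?addr0 => [|j ji].
  rewrite mderivX mnm1E eqxx scale1r.
  suff -> : (U_(i) - U_(i))%MM = 0%MM by rewrite mpolyX0 /peval meval1 mul1r.
  by apply/mnmP => l; rewrite mnmBE subnn mnm0E.
by rewrite mderivX mnm1E eq_sym (negPf ji) scale0r /peval meval0 mul0r.
Qed.
Lemma pdiffD F G p v : pdiff (F + G) p v = pdiff F p v + pdiff G p v.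
Proof.
by rewrite /pdiff -big_split; apply: eq_bigr => i _; rewrite mderivD pevalD mulrDl.
Qed.
Lemma pdiffB F G p v : pdiff (F - G) p v = pdiff F p v - pdiff G p v.
Proof.
rewrite /pdiff -sumrB; apply: eq_bigr => i _.
by rewrite mderivB pevalB mulrBl.
Qed.
Lemma pdiffM F G p v :
  pdiff (F * G) p v = pdiff F p v * peval G p + peval F p * pdiff G p v.
Proof.
rewrite /pdiff mulr_suml mulr_sumr -big_split; apply: eq_bigr => i _.
by rewrite mderivM pevalD !pevalM /=; ring.
Qed.
Lemma coord_sum_vbasis x :
  x = \sum_(i < \dim {:E}) coord (vbasis {:E}) i x *: (vbasis {:E})`_i.
Proof. exact/coord_vbasis/memvf. Qed.

Lemma coord_vbasis_inj x y :
  (forall i, coord (vbasis {:E}) i x = coord (vbasis {:E}) i y) -> x = y.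
Proof.
move=> xy; rewrite (coord_sum_vbasis x) (coord_sum_vbasis y).
by apply: eq_bigr => i _; rewrite xy.
Qed.

Lemma coord_comb (c : 'I_(\dim {:E}) -> K) i :
  coord (vbasis {:E}) i (\sum_j c j *: (vbasis {:E})`_j) = c i.
Proof. by rewrite coord_sum_free // (basis_free (vbasisP _)). Qed.

(** The second component is the differential: carrying it along makes the
    Leibniz rule available without naming a representing polynomial. *)
Definition polydiff f (df : E -> E -> K) :=
  exists F, (forall x, peval F x = f x) /\ (forall p v, pdiff F p v = df p v).

Lemma polydiff_ext f df f' df' : polydiff f df ->
  f =1 f' -> df =2 df' -> polydiff f' df'.
Proof. by move=> [F [Ff Fd]] e1 e2; exists F; split=> *; rewrite ?Ff ?Fd. Qed.
Lemma polydiffC c : polydiff (fun=> c) (fun _ _ => 0).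
Proof. by exists c%:MP; split=> *; rewrite ?pevalC ?pdiffC. Qed.
Lemma polydiffD f df g dg : polydiff f df -> polydiff g dg ->
  polydiff (fun x => f x + g x) (fun p v => df p v + dg p v).
Proof.
move=> [F [Ff Fd]] [G [Gf Gd]]; exists (F + G).
by split=> *; rewrite ?pevalD ?pdiffD ?Ff ?Gf ?Fd ?Gd.
Qed.
Lemma polydiffM f df g dg : polydiff f df -> polydiff g dg ->
  polydiff (fun x => f x * g x) (fun p v => df p v * g p + f p * dg p v).
Proof.
move=> [F [Ff Fd]] [G [Gf Gd]]; exists (F * G).
by split=> *; rewrite ?pevalM ?pdiffM ?Ff ?Gf ?Fd ?Gd.
Qed.
Lemma polydiff_sum I (r : seq I) (f : I -> E -> K) df :
    (forall i, polydiff (f i) (df i)) ->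
  polydiff (fun x => \sum_(i <- r) f i x) (fun p v => \sum_(i <- r) df i p v).
Proof.
move=> fP; elim: r => [|i r IH].
  by apply: (polydiff_ext (polydiffC 0)) => [x|x v]; rewrite big_nil.
by apply: (polydiff_ext (polydiffD (fP i) IH)) => [x|x v]; rewrite big_cons.
Qed.
Definition scalar_of f (sc : scalar f) : {scalar E} :=
  HB.pack f (GRing.isLinear.Build K E K *%R f sc).

Lemma polydiff_linear (f : {scalar E}) : polydiff f (fun _ => f).
Proof.
have := polydiff_sum (index_enum _) (fun i : 'I_(\dim {:E}) => polydiffM
  (polydiffC (f (vbasis {:E})`_i)) (ex_intro _ 'X_i (conj (pevalX i) (pdiffX i)))).
move=> H; apply: (polydiff_ext H) => [x|p x];
  rewrite [in RHS](coord_sum_vbasis x) linear_sum; apply: eq_bigr => i _.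
  by rewrite linearZ /= mulrC.
by rewrite mul0r add0r linearZ /= mulrC.
Qed.

Definition polyfun f := exists F, forall x, peval F x = f x.

Lemma polydiff_fun f df : polydiff f df -> polyfun f.
Proof. by case=> F []; exists F. Qed.
Lemma polyfun_ext f g : polyfun f -> f =1 g -> polyfun g.
Proof. by move=> [F Ff] e; exists F => x; rewrite Ff. Qed.
Lemma polyfunC c : polyfun (fun=> c).
Proof. exact: polydiff_fun (polydiffC c). Qed.
Lemma polyfun_linear (f : {scalar E}) : polyfun f.
Proof. exact: polydiff_fun (polydiff_linear f). Qed.
Lemma polyfunD f g : polyfun f -> polyfun g -> polyfun (fun x => f x + g x).
Proof. by move=> [F Ff] [G Gg]; exists (F + G) => x; rewrite pevalD Ff Gg. Qed.
Lemma polyfunM f g : polyfun f -> polyfun g -> polyfun (fun x => f x * g x).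
Proof. by move=> [F Ff] [G Gg]; exists (F * G) => x; rewrite pevalM Ff Gg. Qed.
Lemma polyfunN f : polyfun f -> polyfun (fun x => - f x).
Proof. by move=> /(polyfunM (polyfunC (-1)))/polyfun_ext; apply=> x; ring. Qed.
Lemma polyfunB f g : polyfun f -> polyfun g -> polyfun (fun x => f x - g x).
Proof. by move=> fP /polyfunN; apply: polyfunD. Qed.
Lemma polyfun_sum I (r : seq I) (P : pred I) (f : I -> E -> K) :
    (forall i, P i -> polyfun (f i)) ->
  polyfun (fun x => \sum_(i <- r | P i) f i x).
Proof.
move=> fP; elim: r => [|i r IH].
  by apply: (polyfun_ext (polyfunC 0)) => x; rewrite big_nil.
case Pi: (P i); last by apply: (polyfun_ext IH) => x; rewrite big_cons Pi.
by apply: (polyfun_ext (polyfunD (fP i Pi) IH)) => x; rewrite big_cons Pi.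
Qed.
Lemma polyfun_prod I (r : seq I) (P : pred I) (f : I -> E -> K) :
    (forall i, P i -> polyfun (f i)) ->
  polyfun (fun x => \prod_(i <- r | P i) f i x).
Proof.
move=> fP; elim: r => [|i r IH].
  by apply: (polyfun_ext (polyfunC 1)) => x; rewrite big_nil.
case Pi: (P i); last by apply: (polyfun_ext IH) => x; rewrite big_cons Pi.
by apply: (polyfun_ext (polyfunM (fP i Pi) IH)) => x; rewrite big_cons Pi.
Qed.
Lemma polyfunX f e : polyfun f -> polyfun (fun x => f x ^+ e).
Proof.
move=> fP; elim: e => [|e IH]; first by apply: (polyfun_ext (polyfunC 1)).
by apply: (polyfun_ext (polyfunM fP IH)) => x; rewrite exprS.
Qed.
Lemma polyfun_meval m (F : {mpoly K[m]}) (f : 'I_m -> E -> K) :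
  (forall i, polyfun (f i)) -> polyfun (fun x => F.@[fun i => f i x]).
Proof.
move=> fP; have [G GP] := choice fP.
exists (F \mPo [tuple G i | i < m]) => x.
rewrite /peval comp_mpoly_meval; apply: meval_eq => i.
by rewrite tnth_mktuple; exact: GP.
Qed.

Definition polymx m n (A : E -> 'M[K]_(m, n)) :=
  forall i j, polyfun (fun x => A x i j).

Lemma polymxC m n (A : 'M[K]_(m, n)) : polymx (fun=> A).
Proof. by move=> i j; apply: polyfunC. Qed.
Lemma polymxD m n (A B : E -> 'M[K]_(m, n)) :
  polymx A -> polymx B -> polymx (fun x => A x + B x).
Proof.
move=> AP BP i j; apply: (polyfun_ext (polyfunD (AP i j) (BP i j))) => x.
by rewrite mxE.
Qed.
Lemma polymxN m n (A : E -> 'M[K]_(m, n)) : polymx A -> polymx (fun x => - A x).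
Proof.
by move=> AP i j; apply: (polyfun_ext (polyfunN (AP i j))) => x; rewrite mxE.
Qed.
Lemma polymxM m n r (A : E -> 'M[K]_(m, n)) (B : E -> 'M[K]_(n, r)) :
  polymx A -> polymx B -> polymx (fun x => A x *m B x).
Proof.
move=> AP BP i j; have H l : true -> polyfun (fun x => A x i l * B x l j).
  by move=> _; apply: polyfunM.
by apply: (polyfun_ext (polyfun_sum _ H)) => x; rewrite mxE.
Qed.
Lemma polymx_tr m n (A : E -> 'M[K]_(m, n)) : polymx A -> polymx (fun x => (A x)^T).
Proof. by move=> AP i j; apply: (polyfun_ext (AP j i)) => x; rewrite mxE. Qed.
Lemma polyfun_det n (A : E -> 'M[K]_n) : polymx A -> polyfun (fun x => \det (A x)).
Proof.
move=> AP; apply: polyfun_sum => s _; apply: polyfunM; first exact: polyfunC.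
by apply: polyfun_prod => i _; apply: AP.
Qed.
Lemma polymx_adj n (A : E -> 'M[K]_n) : polymx A -> polymx (fun x => \adj (A x)).
Proof.
move=> AP i j.
have H : polyfun (fun x => cofactor (A x) j i).
  apply: polyfunM; first exact: polyfunC.
  apply: polyfun_det => a b; apply: (polyfun_ext (AP (lift j a) (lift i b))) => x.
  by rewrite !mxE.
by apply: (polyfun_ext H) => x; rewrite mxE.
Qed.

End PolynomialFunctions.

(** * First-order expansions along rational curves *)

Section Germs.
Context {K : numFieldType}.
Implicit Types (f g : K -> K) (a b c d : K) (p q : {poly K}).

Lemma poly_nonroot p : p != 0 -> exists m : nat, p.[m%:R] != 0.
Proof.
move=> p0; apply: contrapT => nex.
have : (size [seq (i%:R : K) | i <- iota 0 (size p)] < size p)%N.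
  apply: max_poly_roots => //.
    apply/allP => _ /mapP[i _ ->]; apply/negPn/negP => pi.
    by apply: nex; exists i; rewrite -rootE.
  rewrite map_inj_uniq ?iota_uniq // => i j /eqP.
  by rewrite eqr_nat => /eqP.
by rewrite size_map size_iota ltnn.
Qed.

Lemma poly_cofinite0 p q : q != 0 -> (forall t, q.[t] != 0 -> p.[t] = 0) -> p = 0.
Proof.
move=> q0 pq; apply/eqP/negPn/negP => p0.
have [m] := poly_nonroot (mulf_neq0 p0 q0).
by rewrite hornerM mulf_eq0 negb_or => /andP[/eqP pm /pq].
Qed.

(** [f t = a + b t + O(t^2)] for a rational function [f] regular at 0. *)
Definition germ f a b := exists p q : {poly K}, q.[0] != 0 /\
  forall t, q.[t] != 0 -> f t = a + b * t + t ^+ 2 * (p.[t] / q.[t]).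

Lemma germC c : germ (fun=> c) c 0.
Proof. by exists 0, 1; rewrite !hornerE oner_neq0; split=> // t _; rewrite horner0 mul0r; ring. Qed.
Lemma germ_id : germ id 0 1.
Proof. by exists 0, 1; rewrite !hornerE oner_neq0; split=> // t _; rewrite horner0 mul0r; ring. Qed.
Lemma germD f g a b c d : germ f a b -> germ g c d ->
  germ (fun t => f t + g t) (a + c) (b + d).
Proof.
move=> [p [q [q0 fE]]] [r [s [s0 gE]]]; exists (p * s + r * q), (q * s).
rewrite hornerM mulf_neq0 //; split=> // t.
rewrite hornerM mulf_eq0 negb_or => /andP[qt st].
by rewrite fE // gE // !(hornerD, hornerM, hornerC, hornerX, hornerXn); field; rewrite qt st.
Qed.
Lemma germM f g a b c d : germ f a b -> germ g c d ->
  germ (fun t => f t * g t) (a * c) (a * d + b * c).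
Proof.
move=> [p [q [q0 fE]]] [r [s [s0 gE]]].
exists ((b * d)%:P * q * s + (c%:P + d%:P * 'X) * p * s
        + (a%:P + b%:P * 'X) * r * q + 'X^2 * p * r), (q * s).
rewrite hornerM mulf_neq0 //; split=> // t.
rewrite hornerM mulf_eq0 negb_or => /andP[qt st].
by rewrite fE // gE // !(hornerD, hornerM, hornerC, hornerX, hornerXn); field; rewrite qt st.
Qed.
Lemma germ_ext f g a b : germ f a b -> f =1 g -> germ g a b.
Proof. by move=> [p [q [q0 fE]]] e; exists p, q; split=> // t /fE <-. Qed.
Lemma germ_sum I (r : seq I) (f : I -> K -> K) (a b : I -> K) :
  (forall i, germ (f i) (a i) (b i)) ->
  germ (fun t => \sum_(i <- r) f i t) (\sum_(i <- r) a i) (\sum_(i <- r) b i).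
Proof.
move=> fP; elim: r => [|i r IH].
  by rewrite !big_nil; apply: (germ_ext (germC 0)) => t; rewrite big_nil.
by rewrite !big_cons; apply: (germ_ext (germD (fP i) IH)) => t; rewrite big_cons.
Qed.

Lemma germ0 f a b q : q.[0] != 0 -> (forall t, q.[t] != 0 -> f t = 0) ->
  germ f a b -> b = 0.
Proof.
move=> q0 f0 [p [r [r0 fE]]].
have nz (s : {poly K}) : s.[0] != 0 -> s != 0.
  by apply: contraNneq => ->; rewrite horner0.
have num0 : a%:P * r + 'X * (b%:P * r + 'X * p) = 0.
  apply: (@poly_cofinite0 _ (q * r)); first by rewrite mulf_neq0 ?nz.
  move=> t; rewrite hornerM mulf_eq0 negb_or => /andP[qt rt].
  transitivity (f t * r.[t]); last by rewrite f0 ?mul0r.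
  by rewrite fE // !(hornerD, hornerM, hornerC, hornerX); field.
have /(congr1 (horner^~ 0)) := num0; rewrite !hornerE => /eqP.
rewrite mulf_eq0 (negPf r0) orbF => /eqP a0.
move: num0; rewrite a0 mul0r add0r => /eqP.
rewrite mulf_eq0 polyX_eq0 /= => /eqP /(congr1 (horner^~ 0)).
by rewrite !hornerE => /eqP; rewrite mulf_eq0 (negPf r0) orbF => /eqP.
Qed.

Context {E : vectType K}.

(** The chain rule for a rational curve through [x] with velocity [v]. *)
Lemma germ_peval (F : {mpoly K[\dim {:E}]}) (c : K -> E) x v :
  (forall i, germ (fun t => coord (vbasis {:E}) i (c t))
     (coord (vbasis {:E}) i x) (coord (vbasis {:E}) i v)) ->
  germ (fun t => peval F (c t)) (peval F x) (pdiff F x v).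
Proof.
move=> cP; move: F; apply: mpoly_ring_ind => [a|i|F G IF IG|F G IF IG].
- rewrite pevalC pdiffC; apply: (germ_ext (germC a)) => t.
  by rewrite pevalC.
- rewrite pevalX pdiffX; apply: (germ_ext (cP i)) => t.
  by rewrite pevalX.
- rewrite pevalD pdiffD; apply: (germ_ext (germD IF IG)) => t.
  by rewrite pevalD.
rewrite pevalM pdiffM addrC; apply: (germ_ext (germM IF IG)) => t.
by rewrite pevalM.
Qed.

Lemma germ_line x v i : germ (fun t => coord (vbasis {:E}) i (x + t *: v))
  (coord (vbasis {:E}) i x) (coord (vbasis {:E}) i v).
Proof.
have := germD (germC (coord (vbasis {:E}) i x))
              (germM (germC (coord (vbasis {:E}) i v)) germ_id).
rewrite !(mulr0, mul0r, mulr1, addr0, add0r) => H.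
by apply: (germ_ext H) => t; rewrite linearD linearZ /= mulrC.
Qed.

(** The difference vanishes along every line, so its velocity there is 0. *)
Lemma pdiff_ext (F G : {mpoly K[\dim {:E}]}) :
  peval F =1 peval G -> pdiff F =2 pdiff G.
Proof.
move=> FG x v; apply/eqP; rewrite -subr_eq0 -pdiffB; apply/eqP.
apply: (@germ0 (fun t => peval (F - G) (x + t *: v)) (peval (F - G) x) _ 1).
- by rewrite hornerC oner_neq0.
- by move=> t _; rewrite pevalB FG subrr.
- exact/germ_peval/germ_line.
Qed.

Lemma criticalE (W : set E) (f : E -> K) df : polydiff f df ->
  critical W f = [set p | W p /\ forall v, tangent W p v -> df p v = 0].
Proof.
move=> [F [Ff Fd]]; apply/seteqP; split=> p [Wp].
  move=> [G Gf Gd]; split=> // v /Gd; rewrite -Fd => <-.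
  by apply: pdiff_ext => x; rewrite Ff Gf.
by move=> H; split=> //; exists F => // v /H; rewrite Fd.
Qed.

Lemma tangent_curve (W : set E) (c : K -> E) (q : {poly K}) x v :
    q.[0] != 0 -> (forall t, q.[t] != 0 -> W (c t)) ->
    (forall i, germ (fun t => coord (vbasis {:E}) i (c t))
       (coord (vbasis {:E}) i x) (coord (vbasis {:E}) i v)) ->
  tangent W x v.
Proof.
move=> q0 cW cP F FW; apply: (germ0 q0 _ (germ_peval F cP)) => t qt.
exact/FW/cW.
Qed.

End Germs.

(** * Generic sets and polynomials *)

Section Generic.
Context {K : numFieldType}.

Lemma digits_inj b n (u v : 'I_n -> nat) :
    (forall i, u i < b)%N -> (forall i, v i < b)%N ->
  (\sum_(i < n) u i * b ^ i = \sum_(i < n) v i * b ^ i)%N -> u =1 v.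
Proof.
elim: n u v => [|n IH] u v ub vb; first by move=> _ [].
rewrite !big_ord_recl !expn0 !muln1.
have shift (w : 'I_n.+1 -> nat) :
    (\sum_(i < n) w (lift ord0 i) * b ^ lift ord0 i =
     (\sum_(i < n) w (lift ord0 i) * b ^ i) * b)%N.
  by rewrite big_distrl; apply: eq_bigr => i _; rewrite /= expnSr mulnA.
rewrite !shift => e.
have b0 : (0 < b)%N by apply: leq_trans (ub ord0).
have e0 : u ord0 = v ord0.
  have := congr1 (modn^~ b) e.
  by rewrite /= [in LHS]addnC [in RHS]addnC !modnMDl !modn_small.
move/eqP: e; rewrite e0 eqn_add2l eqn_mul2r gtn_eqF //= => /eqP.
move=> /(IH _ _ (fun i => ub _) (fun i => vb _)) e i.
by case: (unliftP ord0 i) => [j ->|->].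
Qed.

(** Kronecker substitution [X_i := T^(b^i)] keeps distinct monomials distinct
    once [b] exceeds the degree, which reduces the claim to one variable. *)
Lemma mpoly_nonroot n (F : {mpoly K[n]}) :
  F != 0 -> exists m : 'I_n -> nat, F.@[fun i => (m i)%:R] != 0.
Proof.
move=> F0; set b := msize F.
pose w (m : 'X_{1..n}) := (\sum_(i < n) m i * b ^ i)%N.
pose q : {poly K} := \sum_(m <- msupp F) F@_m *: 'X^(w m).
have mb m : m \in msupp F -> forall i, (m i < b)%N.
  move=> mF i; apply: leq_ltn_trans (msize_mdeg_lt mF).
  by rewrite mdegE (bigD1 i) //= leq_addr.
have w_inj : {in msupp F &, injective w}.
  by move=> m m' /mb mB /mb mB' /(digits_inj mB mB') e; apply/mnmP.
have q0 : q != 0.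
  have mF := mlead_supp F0.
  apply/eqP => /(congr1 (fun p : {poly K} => p`_(w (mlead F)))).
  rewrite coef0 coef_sum (bigD1_seq (mlead F)) ?msupp_uniq //=.
  rewrite coefZ coefXn eqxx mulr1 big_seq_cond big1 ?addr0 => [/eqP|m].
    by rewrite mleadc_eq0 (negPf F0).
  case/andP=> mF' mm; rewrite coefZ coefXn.
  case: eqP => [/(w_inj _ _ mF mF') e|]; last by rewrite mulr0.
  by rewrite e eqxx in mm.
have [t qt] := poly_nonroot q0.
exists (fun i => (t ^ b ^ i)%N); suff <- : q.[t%:R] = F.@[fun i => (t ^ b ^ i)%:R] by [].
rewrite mevalE horner_sum; apply: eq_bigr => m _.
rewrite hornerZ hornerXn /w -prodrXr; congr (_ * _).
by apply: eq_bigr => i _; rewrite natrX -exprM mulnC.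
Qed.

Context {E : vectType K}.
Implicit Types (P Q : set E) (F : {mpoly K[\dim {:E}]}).

Lemma peval_comb F (c : 'I_(\dim {:E}) -> K) :
  peval F (\sum_i c i *: (vbasis {:E})`_i) = F.@[c].
Proof. by apply: meval_eq => i; rewrite coord_comb. Qed.

Lemma peval_nonroot F : F != 0 -> exists x, peval F x != 0.
Proof.
move=> /mpoly_nonroot[m Fm]; exists (\sum_i (m i)%:R *: (vbasis {:E})`_i).
by rewrite (peval_comb F (fun i => (m i)%:R)).
Qed.

Lemma generic_poly P F : F != 0 -> (forall x, peval F x != 0 -> P x) -> generic P.
Proof.
move=> /peval_nonroot[x Fx] FP; exists [set y | peval F y = 0]; split.
- exists [set F]; apply/seteqP; split=> y /=; first by move=> e _ ->.
  by apply.
- by move=> /seteqP[_ /(_ x I)] /= e; rewrite e eqxx in Fx.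
- by move=> y /= /eqP; apply: FP.
Qed.

Lemma generic_polyfun P (f : E -> K) x : polyfun f -> f x != 0 ->
  (forall y, f y != 0 -> P y) -> generic P.
Proof.
move=> [F Ff] fx fP; apply: (@generic_poly _ F) => [|y]; last by rewrite Ff; apply: fP.
apply: contraNneq fx => F0; have := Ff x.
by rewrite F0 /peval meval0 => <-.
Qed.

Lemma generic_polyP P : generic P ->
  exists2 F, F != 0 & forall x, peval F x != 0 -> P x.
Proof.
move=> [Z [[I ZI] ZT ZP]].
have [x xZ] : exists x, ~ Z x.
  apply: contrapT => nex; apply: ZT; apply/seteqP; split=> // x _.
  by apply: contrapT => xZ; apply: nex; exists x.
have [F [IF Fx]] : exists F, I F /\ peval F x <> 0.
  apply: contrapT => nex; apply: xZ; rewrite ZI => F IF.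
  by apply: contrapT => Fx; apply: nex; exists F.
exists F => [|y Fy]; first by apply/eqP => F0; apply: Fx; rewrite F0 /peval meval0.
by apply: ZP; rewrite ZI => /= /(_ F IF) e; rewrite e eqxx in Fy.
Qed.

Lemma generic_sub P Q : P `<=` Q -> generic P -> generic Q.
Proof. by move=> PQ [Z [Zc ZT ZP]]; exists Z; split=> // x /ZP/PQ. Qed.

Lemma generic_and P Q : generic P -> generic Q -> generic (P `&` Q).
Proof.
move=> /generic_polyP[F F0 FP] /generic_polyP[G G0 GQ].
apply: (@generic_poly _ (F * G)) => [|x]; first exact: mulf_neq0.
by rewrite pevalM mulf_eq0 negb_or => /andP[/FP ? /GQ].
Qed.

Lemma generic_setT : generic [set: E].
Proof. by apply: (@generic_poly _ 1); rewrite ?oner_neq0. Qed.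

Lemma generic_nonempty P : generic P -> exists x, P x.
Proof. by move=> /generic_polyP[F /peval_nonroot[x Fx] FP]; exists x; apply: FP. Qed.

Lemma generic_forall (I : finType) (P : I -> set E) :
  (forall i, generic (P i)) -> generic [set x | forall i, P i x].
Proof.
move=> gP; suff : generic [set x | forall i, i \in enum I -> P i x].
  by apply: generic_sub => x + i; apply; rewrite mem_enum.
elim: (enum I) => [|i r IH]; first by apply: generic_sub generic_setT.
apply: generic_sub (generic_and (gP i) IH) => x [/= ? H] j.
by rewrite inE => /predU1P[->|/H].
Qed.

End Generic.

(** * Definable families of finite sets *)

Section Definable.
Context {C : numClosedFieldType}.

Definition env {E : vectType C} (x : E) : seq C :=
  [seq coord (vbasis {:E}) i x | i <- enum 'I_(\dim {:E})].

Lemma size_env {E : vectType C} (x : E) : size (env x) = \dim {:E}.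
Proof. by rewrite size_map size_enum_ord. Qed.

Lemma nth_env {E : vectType C} (x : E) (i : 'I_(\dim {:E})) :
  (env x)`_i = coord (vbasis {:E}) i x.
Proof. by rewrite (nth_map i) ?size_enum_ord // nth_ord_enum. Qed.

Section Terms.
Context {T : Type} (ev : T -> seq C).

Definition tdef (g : T -> C) :=
  exists t, GRing.rterm t /\ forall x, GRing.eval (ev x) t = g x.
Definition fdef (P : T -> Prop) :=
  exists f, GRing.rformula f /\ forall x, GRing.holds (ev x) f <-> P x.

Lemma tdefC c : tdef (fun=> c). Proof. by exists (GRing.Const c). Qed.
Lemma tdef_nth i : tdef (fun x => (ev x)`_i). Proof. by exists (GRing.Var C i). Qed.
Lemma tdefD g h : tdef g -> tdef h -> tdef (fun x => g x + h x).
Proof.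
move=> [t [rt te]] [s [rs se]]; exists (GRing.Add t s) => /=.
by rewrite rt rs; split=> // x; rewrite te se.
Qed.
Lemma tdefM g h : tdef g -> tdef h -> tdef (fun x => g x * h x).
Proof.
move=> [t [rt te]] [s [rs se]]; exists (GRing.Mul t s) => /=.
by rewrite rt rs; split=> // x; rewrite te se.
Qed.
Lemma tdef_ext g h : tdef g -> g =1 h -> tdef h.
Proof. by move=> [t [rt te]] e; exists t; split=> // x; rewrite te. Qed.
Lemma tdef_sum I (r : seq I) (g : I -> T -> C) :
  (forall i, tdef (g i)) -> tdef (fun x => \sum_(i <- r) g i x).
Proof.
move=> gP; elim: r => [|i r IH].
  by apply: (tdef_ext (tdefC 0)) => x; rewrite big_nil.
by apply: (tdef_ext (tdefD (gP i) IH)) => x; rewrite big_cons.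
Qed.

Lemma fdef_ext P Q : fdef P -> (forall x, P x <-> Q x) -> fdef Q.
Proof.
by move=> [f [rf fP]] PQ; exists f; split=> // x; apply: iff_trans (PQ x).
Qed.
Lemma fdef_eq0 g : tdef g -> fdef (fun x => g x = 0).
Proof.
move=> [t [rt te]]; exists (GRing.Equal t (GRing.Const 0)) => /=.
by rewrite rt; split=> // x; rewrite te.
Qed.
Lemma fdef_eq g h : tdef g -> tdef h -> fdef (fun x => g x = h x).
Proof.
move=> [t [rt te]] [s [rs se]]; exists (GRing.Equal t s) => /=.
by rewrite rt rs; split=> // x; rewrite te se.
Qed.
Lemma fdef_not P : fdef P -> fdef (fun x => ~ P x).
Proof.
move=> [f [rf fP]]; exists (GRing.Not f); split=> // x /=.
by split=> H /fP.
Qed.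
Lemma fdef_and P Q : fdef P -> fdef Q -> fdef (fun x => P x /\ Q x).
Proof.
move=> [f [rf fP]] [g [rg gQ]]; exists (GRing.And f g) => /=.
by rewrite rf rg; split=> // x; split=> -[/fP ? /gQ].
Qed.
Lemma fdef_true (P : Prop) : P -> fdef (fun=> P).
Proof. by move=> HP; exists (GRing.Bool true); split. Qed.
Lemma fdef_imp (P : Prop) Q : fdef Q -> fdef (fun x => P -> Q x).
Proof.
move=> dQ; have [HP|HP] := pselect P; first by apply: (fdef_ext dQ) => x; split; auto.
by apply: (fdef_ext (fdef_true HP)) => x; split.
Qed.
Lemma fdef_forall (I : finType) (P : I -> T -> Prop) :
  (forall i, fdef (P i)) -> fdef (fun x => forall i, P i x).
Proof.
move=> dP; suff H r : fdef (fun x => forall i, i \in (r : seq I) -> P i x).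
  apply: (fdef_ext (H (enum I))) => x; split=> Px i //.
  by apply: Px; rewrite mem_enum.
elim: r => [|i r IH]; first by apply: (fdef_ext (fdef_true Logic.I)) => x; split.
apply: (fdef_ext (fdef_and (dP i) IH)) => x; split=> [[Pi Pr] j|H].
  by rewrite inE => /predU1P[->|/Pr].
by split=> [|j jr]; apply: H; rewrite inE ?eqxx ?jr ?orbT.
Qed.

End Terms.

Context {E : vectType C}.

Lemma qf_dichotomy (f : GRing.formula C) : GRing.qf_form f && GRing.rformula f ->
  generic [set x : E | GRing.holds (env x) f] \/
  generic [set x : E | ~ GRing.holds (env x) f].
Proof.
have term_poly t : GRing.rterm t -> polyfun (fun x : E => GRing.eval (env x) t).
  elim: t => //=.
  - move=> i _; case: (ltnP i (\dim {:E})) => [iN|Ni].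
      apply: (polyfun_ext (polyfun_linear (coord (vbasis {:E}) (Ordinal iN)))) => x.
      exact/esym/(nth_env x (Ordinal iN)).
    by apply: (polyfun_ext (polyfunC 0)) => x; rewrite nth_default // size_env.
  - by move=> c _; apply: polyfunC.
  - by move=> m _; apply: polyfunC.
  - by move=> t IHt s IHs /andP[/IHt ? /IHs]; apply: polyfunD.
  - by move=> t IHt /IHt; apply: polyfunN.
  - move=> t IHt m /IHt/(polyfunM (polyfunC m%:R))/polyfun_ext; apply=> x.
    by rewrite mulr_natl.
  - by move=> t IHt s IHs /andP[/IHt ? /IHs]; apply: polyfunM.
  - by move=> t IHt m /IHt; apply: polyfunX.
have genT (P : set E) : (forall x, P x) -> generic P.
  by move=> PT; apply: generic_sub generic_setT => x _; apply: PT.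
elim: f => //=.
- by move=> [] _; [left|right]; apply: genT.
- move=> t s /andP[/term_poly [F FE] /term_poly[G GE]].
  have [FG|FG] := eqVneq (F - G) 0; [left; apply: genT => x /=|right].
    by apply/eqP; rewrite -FE -GE -subr_eq0 -pevalB FG /peval meval0.
  apply: (generic_poly FG) => x; rewrite pevalB FE GE.
  by rewrite subr_eq0 => /eqP.
- move=> f IHf g IHg /andP[/andP[qf qg] /andP[rf rg]].
  case: IHf; rewrite ?qf // => gf; last first.
    by right; apply: generic_sub gf => x /= H [].
  case: IHg; rewrite ?qg // => gg; last first.
    by right; apply: generic_sub gg => x /= H [].
  by left; apply: generic_sub (generic_and gf gg).
- move=> f IHf g IHg /andP[/andP[qf qg] /andP[rf rg]].
  case: IHf; rewrite ?qf // => gf.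
    by left; apply: generic_sub gf => x /=; left.
  case: IHg; rewrite ?qg // => gg.
    by left; apply: generic_sub gg => x /=; right.
  by right; apply: generic_sub (generic_and gf gg) => x /= [? ?] [].
- move=> f IHf g IHg /andP[/andP[qf qg] /andP[rf rg]].
  case: IHf; rewrite ?qf // => gf; last first.
    by left; apply: generic_sub gf => x /= H.
  case: IHg; rewrite ?qg // => gg.
    by left; apply: generic_sub gg => x /=.
  by right; apply: generic_sub (generic_and gf gg) => x /= [? H] /(_ _)/H; apply.
- move=> f IHf fP; case: (IHf fP) => gf; [right|left] => //.
  by apply: generic_sub gf => x /= Hx; apply.
Qed.

(** Quantifier elimination turns the formula into a Boolean combination of
    polynomial equations, and each equation either holds identically or fails
    generically. *)
Lemma fdef_dichotomy (P : set E) : fdef env P -> generic P \/ generic (~` P).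
Proof.
move=> [f [rf fP]].
pose g := GRing.quantifier_elim (@ClosedFieldQE.ex_elim C) f.
have wf := @ClosedFieldQE.wf_ex_elim C.
have ok := ClosedFieldQE.holds_ex_elim (@solve_monicpoly C).
have gP : GRing.qf_form g && GRing.rformula g by apply: GRing.quantifier_elim_wf.
have gE x : GRing.holds (env x) g <-> P x.
  have /andP[qg _] := gP; apply: iff_trans (fP x).
  apply: (iff_trans (rwP (GRing.qf_evalP _ qg))).
  exact: iff_sym (rwP (GRing.quantifier_elim_rformP wf ok _ rf)).
case: (qf_dichotomy gP) => H; [left|right]; apply: generic_sub H => x.
  by move/gE.
by move=> H /gE.
Qed.

(** The coordinates of [y] are the variables that follow those of [x]; binding
    all of them by quantifiers leaves a formula in the coordinates of [x]. *)
Lemma fdef_exists (E' : vectType C) (P : E * E' -> Prop) :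
    fdef (fun xy => env xy.1 ++ env xy.2) P ->
  fdef env (fun x => exists y, P (x, y)).
Proof.
move=> [f [rf fP]]; set N : nat := \dim {:E}; set M : nat := \dim {:E'}.
exists (foldr GRing.Exists f (iota N M)); split.
  by elim: (iota _ _).
move=> x; apply: (iff_trans (iff_sym (GRing.foldExistsP _ _ _))); split.
  move=> [e' e'E fe']; exists (\sum_(j < M) e'`_(N + j) *: (vbasis {:E'})`_j).
  apply/fP; apply: GRing.eq_holds fe' => i /=; rewrite nth_cat size_env.
  case: ltnP => [iN|Ni]; first by rewrite e'E // inE mem_iota leqNgt iN.
  have [iM|Mi] := ltnP (i - N) M.
    rewrite -[in LHS](subnKC Ni) (nth_env _ (Ordinal iM)) -/N.
    by rewrite (coord_comb (fun j : 'I_M => e'`_(N + j))).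
  rewrite [RHS]nth_default ?size_env // -e'E ?nth_default ?size_env //.
  by rewrite inE mem_iota -ltn_subLR // negb_and orbC -leqNgt Mi.
move=> [y /fP fy]; exists (env x ++ env y) => // i.
rewrite inE mem_iota nth_cat size_env negb_and -leqNgt -ltnNge -/N.
case: ltnP => //= Ni H.
by rewrite !nth_default ?size_env // leq_subRL.
Qed.

Definition atleast {T} d (A : set T) :=
  exists y : {ffun 'I_d -> T}, injective y /\ forall l, A (y l).

Lemma atleast_card (T : eqType) d (A : set T) :
  atleast d A -> ~ atleast d.+1 A -> A #= `I_d.
Proof.
move=> [y [y_inj yA]] nA.
have -> : A = y @` [set: 'I_d].
  apply/seteqP; split=> [x Ax|_ [l _ <-]] //.
  apply: contrapT => xy; apply: nA.
  exists [ffun l => if unlift ord_max l is Some j then y j else x]; split.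
    move=> a b; rewrite !ffunE.
    case: unliftP => [a' ->|->]; case: unliftP => [b' ->|->] //.
    - by move=> /y_inj ->.
    - by move=> e; case: xy; exists a'.
    - by move=> e; case: xy; exists b'.
  by move=> l; rewrite ffunE; case: unliftP.
apply: card_eq_trans (card_esym card_II).
by apply: inj_card_eq => a b _ _; apply: y_inj.
Qed.

(** Inductive, because [generic_card] transports these functions to a space
    where one of [d] unknown points takes the place of the second argument. *)
Inductive bipoly : (E -> E -> C) -> Prop :=
| BipolyC c : bipoly (fun _ _ => c)
| BipolyL (f : {scalar E}) : bipoly (fun x _ => f x)
| BipolyR (f : {scalar E}) : bipoly (fun _ y => f y)
| BipolyD g h : bipoly g -> bipoly h -> bipoly (fun x y => g x y + h x y)
| BipolyM g h : bipoly g -> bipoly h -> bipoly (fun x y => g x y * h x y).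

Lemma bipoly_sum I (r : seq I) (g : I -> E -> E -> C) :
  (forall i, bipoly (g i)) ->
  exists2 h, bipoly h & forall x y, h x y = \sum_(i <- r) g i x y.
Proof.
move=> gP; elim: r => [|i r [h hP hE]].
  by exists (fun _ _ => 0); [exact: BipolyC|move=> x y; rewrite big_nil].
exists (fun x y => g i x y + h x y); first exact: BipolyD.
by move=> x y; rewrite big_cons hE.
Qed.

(** Having at least [d] solutions is a definable condition on [x], hence
    generically true or generically false; the bound [M] makes it fail for some
    [d], and the last [d] before that is the generic number of solutions. *)
Theorem generic_card (I : finType) (g : I -> E -> E -> C) (S : E -> set E) M :
    (forall i, bipoly (g i)) ->
    (forall x y, S x y <-> forall i, g i x y = 0) ->
    generic [set x | ~ atleast M (S x)] ->
  exists d, generic [set x | S x #= `I_d].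
Proof.
move=> gP SE bounded.
have dich d : generic [set x | atleast d (S x)] \/ generic [set x | ~ atleast d (S x)].
  pose E' : vectType C := {ffun 'I_d -> E}.
  pose ev (xy : E * E') := env xy.1 ++ env xy.2.
  have linL (f : {scalar E}) : tdef ev (fun xy => f xy.1).
    apply: (@tdef_ext _ _ (fun xy => \sum_(i < \dim {:E}) f (vbasis {:E})`_i * (ev xy)`_i)).
      by apply: tdef_sum => i; apply: tdefM; [apply: tdefC|apply: tdef_nth].
    move=> [x y] /=; rewrite [in RHS](coord_sum_vbasis x) linear_sum.
    apply: eq_bigr => i _; rewrite linearZ /= mulrC nth_cat size_env ltn_ord.
    by rewrite nth_env.
  have linR (f : {scalar E'}) : tdef ev (fun xy => f xy.2).
    apply: (@tdef_ext _ _ (fun xy => \sum_(i < \dim {:E'})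
              f (vbasis {:E'})`_i * (ev xy)`_(\dim {:E} + i))).
      by apply: tdef_sum => i; apply: tdefM; [apply: tdefC|apply: tdef_nth].
    move=> [x y] /=; rewrite [in RHS](coord_sum_vbasis y) linear_sum.
    apply: eq_bigr => i _; rewrite linearZ /= mulrC nth_cat size_env.
    by rewrite ltnNge leq_addr /= addKn nth_env.
  have linR1 l (f : {scalar E}) : tdef ev (fun xy => f (xy.2 l)).
    have sc : scalar (fun y : E' => f (y l)).
      by move=> a u v; rewrite !ffunE linearP.
    exact: (linR (scalar_of sc)).
  have bip l h : bipoly h -> tdef ev (fun xy => h xy.1 (xy.2 l)).
    elim=> [c|f|f|h1 h2 _ IH1 _ IH2|h1 h2 _ IH1 _ IH2].
    - exact: tdefC.
    - exact: linL.
    - exact: linR1.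
    - exact: tdefD.
    - exact: tdefM.
  apply: (@fdef_dichotomy [set x | atleast d (S x)]).
  apply: (@fdef_ext _ _ (fun x => exists y : E',
    (forall l l' : 'I_d, l != l' -> ~ (forall j : 'I_(\dim {:E}),
      coord (vbasis {:E}) j (y l) = coord (vbasis {:E}) j (y l'))) /\
    (forall (l : 'I_d) i, g i x (y l) = 0))).
    apply: (@fdef_exists E' (fun xy : E * E' =>
      (forall l l' : 'I_d, l != l' -> ~ (forall j : 'I_(\dim {:E}),
        coord (vbasis {:E}) j (xy.2 l) = coord (vbasis {:E}) j (xy.2 l'))) /\
      (forall (l : 'I_d) i, g i xy.1 (xy.2 l) = 0))).
    apply: fdef_and; apply: fdef_forall => l; apply: fdef_forall => i.
      apply/fdef_imp/fdef_not/fdef_forall => j.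
      by apply: fdef_eq; apply: linR1.
    by apply: fdef_eq0; apply: bip.
  move=> x; split=> -[y [yi yS]]; exists y; split.
  - move=> l l' e; apply/eqP; apply: contraPT (erefl (y l)) => /yi ll _.
    by apply: ll => j; rewrite e.
  - by move=> l; exact: (proj2 (SE _ _) (yS l)).
  - by move=> l l' /eqP ll H; apply/ll/yi/coord_vbasis_inj.
  - by move=> l; exact: (proj1 (SE _ _) (yS l)).
have gen0 : generic [set x | atleast 0 (S x)].
  apply: generic_sub generic_setT => x _.
  by exists [ffun=> x]; split=> [[]|[]].
(* Having [d] solutions is generic for [d = 0] but not for [d = M], so it
   ceases to be generic at some [d]. *)
have [d gd ngd] : exists2 d, generic [set x | atleast d (S x)] &
    ~ generic [set x | atleast d.+1 (S x)].
  apply: contrapT => nex.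
  have gall d : generic [set x | atleast d (S x)].
    elim: d => // d IH; apply: contrapT => ?; apply: nex; exists d => //.
  by have [x [/= ? ?]] := generic_nonempty (generic_and bounded (gall M)).
exists d; case: (dich d.+1) => // gd'.
by apply: generic_sub (generic_and gd gd') => x [/= ? ?]; apply: atleast_card.
Qed.

End Definable.

(** * Algebraic dependence and generic finiteness *)

Lemma linear_dependence (K : fieldType) (X Y : finType) (M : X -> Y -> K) :
  (#|Y| < #|X|)%N ->
  exists c : X -> K, (exists x, c x != 0) /\ forall y, \sum_x c x * M x y = 0.
Proof.
move=> YX; pose A := \matrix_(i < #|X|, j < #|Y|) M (enum_val i) (enum_val j).
have kerA0 : kermx A != 0.
  rewrite -mxrank_eq0 mxrank_ker subn_eq0 -ltnNge.
  exact: leq_ltn_trans (rank_leq_col A) YX.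
pose r := nz_row (kermx A); have r0 : r != 0 by rewrite nz_row_eq0.
have rA : r *m A = 0 by apply/sub_kermxP/nz_row_sub.
exists (fun x => r 0 (enum_rank x)); split.
  have /rV0Pn[i ri] := r0; exists (enum_val i).
  by rewrite enum_valK.
move=> y; have /matrixP/(_ 0 (enum_rank y)) := rA; rewrite !mxE => e; rewrite -[RHS]e.
rewrite [RHS](reindex (@enum_rank X)) /=; last exact/onW_bij/enum_rank_bij.
by apply: eq_bigr => x _; rewrite mxE !enum_rankK.
Qed.

Section Dependence.
Context {K : fieldType} {n : nat}.
Implicit Types (F G : {mpoly K[n]}).

Lemma msizeM_bound F G d e :
  (msize F <= d.+1 -> msize G <= e.+1 -> msize (F * G) <= (d + e).+1)%N.
Proof.
move=> Fd Ge; have [->|F0] := eqVneq F 0; first by rewrite mul0r msize0.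
have [->|G0] := eqVneq G 0; first by rewrite mulr0 msize0.
rewrite msizeM // -ltnS prednK.
  by apply: leq_trans (leq_add Fd Ge) _; rewrite addnS addSn.
by rewrite addn_gt0 lt0n msize_poly_eq0 F0.
Qed.

Lemma msizeX_bound F d e : (msize F <= d.+1 -> msize (F ^+ e) <= (d * e).+1)%N.
Proof.
move=> Fd; elim: e => [|e IH]; first by rewrite expr0 msize1.
by rewrite exprS mulnS; apply: msizeM_bound.
Qed.

Lemma msize_prod_bound (I : finType) (F : I -> {mpoly K[n]}) d :
  (forall i, msize (F i) <= d.+1)%N -> (msize (\prod_i F i) <= (#|I| * d).+1)%N.
Proof.
move=> Fd; rewrite -sum_nat_const.
by elim/big_rec2: _ => [|i e G _ IH]; [rewrite msize1|apply: msizeM_bound].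
Qed.

(** A dimension count: the products of fewer than [m] factors from each of the
    [n+1] rational functions [a i / q] and [z / q] number [m^(n+1)], but they lie
    in a space of dimension [O(m^n)], so they satisfy a linear relation.  It is
    written as a polynomial in [z / q]. *)
Lemma algebraic_dependence (a : 'I_n -> {mpoly K[n]}) (z q : {mpoly K[n]}) :
  exists m (g : 'I_m -> {mpoly K[n]}), (exists l, g l != 0) /\
    forall v, q.@[v] != 0 ->
      \sum_l (g l).@[fun i => (a i).@[v] / q.@[v]] * (z.@[v] / q.@[v]) ^+ l = 0.
Proof.
pose D := maxn (msize z) (maxn (msize q) (\max_i msize (a i))).
have zD : (msize z <= D.+1)%N by rewrite leqW // leq_maxl.
have qD : (msize q <= D.+1)%N.
  by rewrite leqW // (leq_trans _ (leq_maxr _ _)) // leq_maxl.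
have aD i : (msize (a i) <= D.+1)%N.
  rewrite leqW // (leq_trans _ (leq_maxr _ _)) // (leq_trans _ (leq_maxr _ _)) //.
  exact: (leq_bigmax i).
(* There are [m ^ n.+1] products [pr x], and their exponents are below [T]; this
   [m] makes [T ^ n < m ^ n.+1]. *)
have [m Dm] : exists m, ((n.+1 * D).+1 ^ n < m)%N by exists ((n.+1 * D).+1 ^ n).+1.
have m0 : (0 < m)%N by apply: leq_ltn_trans Dm.
pose T := (n.+1 * (D * m)).+1.
pose X := ({ffun 'I_n -> 'I_m} * 'I_m)%type.
pose pw F (u : nat) := F ^+ u * q ^+ (m - u).
have pwD F (u : 'I_m) : (msize F <= D.+1)%N -> (msize (pw F u) <= (D * m).+1)%N.
  move=> FD; rewrite -[in X in (_ <= X.+1)%N](subnKC (ltnW (ltn_ord u))) mulnDr.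
  by apply: msizeM_bound; apply: msizeX_bound.
pose pr (x : X) := pw z x.2 * \prod_i pw (a i) (x.1 i).
have prT (x : X) : (msize (pr x) <= T)%N.
  apply: (@msizeM_bound _ _ (D * m) (n * (D * m))); first exact: pwD.
  rewrite -[X in (X * _)%N]card_ord; apply: msize_prod_bound => i; exact: pwD.
have [|c [[[u0 l0] c0] cP]] := @linear_dependence K X {ffun 'I_n -> 'I_T}
    (fun x y => (pr x)@_[multinom val (y i) | i < n]).
  rewrite card_prod !card_ffun !card_ord -expnSr.
  apply: (@leq_ltn_trans ((n.+1 * D).+1 ^ n * m ^ n)).
    have Tm : (T <= (n.+1 * D).+1 * m)%N.
      by rewrite /T mulnA [X in (_ <= X)%N]mulSn -[X in (X <= _)%N]add1n leq_add2r.
    rewrite -expnMn; have [n0|n0] := posnP n; last by rewrite leq_exp2r.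
    by rewrite [in X in (X <= _)%N]n0 [in X in (_ <= X)%N]n0.
  by rewrite expnS ltn_pmul2r // expn_gt0 m0.
have sum0 : \sum_x c x *: pr x = 0.
  apply/mpolyP => w; rewrite mcoeff0 raddf_sum /=.
  have [/forallP wT|] := boolP [forall i, (w i < T)%N].
    rewrite -[RHS](cP [ffun i => Ordinal (wT i)]); apply: eq_bigr => x _.
    rewrite mcoeffZ; congr (_ * _@__).
    by apply/mnmP => i; rewrite mnmE ffunE.
  case/forallPn => i; rewrite -leqNgt => Tw.
  rewrite big1 // => x _; rewrite mcoeffZ memN_msupp_eq0 ?mulr0 //.
  apply: msize_mdeg_ge; apply: leq_trans (prT x) (leq_trans Tw _).
  by rewrite mdegE (bigD1 i) //= leq_addr.
exists m, (fun l => \sum_(u : {ffun 'I_n -> 'I_m}) c (u, l) *: 'X_[[multinom val (u i) | i < n]]).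
split.
  exists l0; apply: contraNneq c0 => /(congr1 (mcoeff [multinom val (u0 i) | i < n])).
  rewrite mcoeff0 raddf_sum /= (bigD1 u0) //= big1 ?addr0 => [|u uu0].
    by rewrite mcoeffZ mcoeffX eqxx mulr1 => ->.
  rewrite mcoeffZ mcoeffX; case: eqP => [/mnmP e|]; last by rewrite mulr0.
  case/eqP: uu0; apply/ffunP => i; apply/val_inj.
  by have := e i; rewrite !mnmE.
move=> v q0.
have pwE F (u : 'I_m) : (F.@[v] / q.@[v]) ^+ u = (pw F u).@[v] / q.@[v] ^+ m.
  have -> : q.@[v] ^+ m = q.@[v] ^+ u * q.@[v] ^+ (m - u).
    by rewrite -exprD subnKC // ltnW.
  rewrite mevalM !rmorphXn /= expr_div_n invfM mulrACA mulfV ?mulr1 //.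
  by rewrite expf_neq0.
have -> : \sum_l (\sum_(u : {ffun 'I_n -> 'I_m}) c (u, l) *: 'X_[[multinom val (u i) | i < n]]).@[
     fun i => (a i).@[v] / q.@[v]] * (z.@[v] / q.@[v]) ^+ l =
   (\sum_x c x *: pr x).@[v] / q.@[v] ^+ (n.+1 * m).
  have -> : \sum_x c x *: pr x = \sum_l \sum_u c (u, l) *: pr (u, l).
    by rewrite exchange_big pair_bigA; apply: eq_bigr => -[].
  rewrite raddf_sum /= [RHS]mulr_suml; apply: eq_bigr => l _.
  rewrite !raddf_sum /= [LHS]mulr_suml [RHS]mulr_suml; apply: eq_bigr => u _ /=.
  rewrite !mevalZ mevalX pwE /pr /= [(_ * \prod_i _).@[v]]mevalM rmorph_prod -!mulrA; congr (_ * _).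
  rewrite mulrC mulSn exprD [(n * m)%N]mulnC exprM invfM -!mulrA; congr (_ * _).
  rewrite mulrCA; congr (_ * _).
  rewrite -[X in _ / (_ ^+ X)]card_ord -prodr_const -prodf_div.
  by apply: eq_bigr => i _; rewrite mnmE pwE.
by rewrite sum0 meval0 mul0r.
Qed.

End Dependence.

Section GenericFinite.
Context {C : numClosedFieldType} {E : vectType C}.
Local Notation crd := (coord (vbasis {:E})).

(** On the locus where the relation of [algebraic_dependence] stays nontrivial
    after fixing [x], it confines [z / q] to its roots. *)
Lemma generic_values (A : E -> E) (z q : E -> C) :
    (forall i, polyfun (fun t => crd i (A t))) -> polyfun z -> polyfun q ->
  exists m, generic [set x : E | exists s : seq C, (size s <= m)%N /\
    forall t c, q t != 0 -> q t *: x = A t -> q t * c = z t -> c \in s].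
Proof.
move=> AP [Z ZE] [Q QE]; have [a aE] := choice AP.
have [m [g [[l gl] gP]]] := algebraic_dependence a Z Q.
exists m; apply: (generic_poly gl) => x gx.
pose p : {poly C} := \poly_(j < m) (if insub j is Some l then peval (g l) x else 0).
have pE (j : 'I_m) : p`_j = peval (g j) x by rewrite coef_poly ltn_ord valK.
have p0 : p != 0 by apply: contraNneq gx => p0; rewrite -pE p0 coef0.
have [s sE] := closed_field_poly_normal p; exists s; split=> [|t c qt xA cz].
  have := size_poly m (fun j => if insub j is Some l then peval (g l) x else 0).
  rewrite -/p sE size_scale ?lead_coef_eq0 // size_prod_XsubC.
  exact: ltnW.
have : root p c.
  rewrite rootE (@horner_coef_wide _ m) ?size_poly //; apply/eqP.
  rewrite -[RHS](gP (fun i => crd i t)).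
    apply: eq_bigr => j _; rewrite pE; congr (_ * _ ^+ _).
      apply: meval_eq => i; rewrite -![_.@[_]]/(peval _ _) aE QE -xA linearZ /=.
      by field.
    by rewrite -![_.@[_]]/(peval _ _) ZE QE -cz; field.
  by rewrite -[_.@[_]]/(peval _ _) QE.
by rewrite sE rootZ ?lead_coef_eq0 // root_prod_XsubC.
Qed.

(** There are no more parameters [t] than coordinates of [x], so each
    coordinate of [y = Y t / q t] depends algebraically on [x = A t / q t]. *)
Lemma generic_bounded (S : E -> set E) (A Y : E -> E) (q : E -> C) :
    (forall i, polyfun (fun t => crd i (A t))) ->
    (forall i, polyfun (fun t => crd i (Y t))) -> polyfun q ->
    (forall x y, S x y -> exists t, [/\ q t != 0, q t *: x = A t & q t *: y = Y t]) ->
  exists M, generic [set x | ~ atleast M (S x)].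
Proof.
move=> AP YP qP cover.
have [m mP] := choice (fun i => generic_values AP (YP i) qP).
exists ((\max_i m i).+1 ^ \dim {:E}).+1.
apply: generic_sub (generic_forall mP) => x /= xP [y [y_inj yS]].
have [s sP] := choice xP.
(* A solution is determined by the positions of its coordinates in the lists of
   admissible values. *)
pose h l : {ffun 'I_(\dim {:E}) -> 'I_(\max_i m i).+1} :=
  [ffun i => inord (index (crd i (y l)) (s i))].
have ys l i : crd i (y l) \in s i.
  have [t [qt xA yY]] := cover _ _ (yS l).
  by have [_ H] := sP i; apply: H qt xA _; rewrite -yY linearZ.
have h_inj : injective h.
  move=> l l' /ffunP e; apply/y_inj/coord_vbasis_inj => i.
  have := congr1 (@nat_of_ord _) (e i); rewrite !ffunE !inordK; last 2 first.
  - rewrite ltnS (leq_trans _ (leq_bigmax i)) //; have [+ _] := sP i.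
    by apply: leq_trans; apply: index_size.
  - rewrite ltnS (leq_trans _ (leq_bigmax i)) //; have [+ _] := sP i.
    by apply: leq_trans; apply: index_size.
  move=> /(congr1 (nth 0 (s i))).
  by rewrite !nth_index.
have := leq_card h h_inj.
by rewrite card_ffun !card_ord ltnn.
Qed.

End GenericFinite.

(** * Tuples of symmetric matrices *)

Lemma mxtrace_mul_delta (R : comPzRingType) n (M : 'M[R]_n) a b :
  \tr (M *m delta_mx a b) = M b a.
Proof.
rewrite mxtrace_mulC /mxtrace (bigD1 a) //= big1 ?addr0 => [|c ca].
  rewrite mxE (bigD1 b) //= big1 ?addr0 => [|d db]; first by rewrite mxE !eqxx mul1r.
  by rewrite mxE (negPf db) andbF mul0r.
by rewrite mxE big1 // => d _; rewrite mxE (negPf ca) mul0r.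
Qed.

Section SymTuples.
Context {K : numFieldType} {k n : nat}.
Local Notation E := {ffun 'I_k -> Sym K n}.
Implicit Types (A B P V : E) (i j : 'I_k) (a b : 'I_n).

Lemma symmx_tr (A : Sym K n) : (symmx A)^T = symmx A.
Proof. by have /fixedSpaceP := subvsP A; rewrite lfunE. Qed.

Lemma symmxC (A : Sym K n) a b : symmx A a b = symmx A b a.
Proof. by rewrite -[in RHS]symmx_tr mxE. Qed.

Definition mksym (M : 'M[K]_n) : Sym K n :=
  vsproj (fixedSpace (linfun (@trmx K n n))) M.

Lemma mksymK (M : 'M[K]_n) : M^T = M -> symmx (mksym M) = M.
Proof. by move=> MT; apply/vsprojK/fixedSpaceP; rewrite lfunE. Qed.

Lemma symmx_inj : injective (@symmx K n).
Proof. exact: subvs_inj. Qed.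

Lemma symmxP c (A B : Sym K n) : symmx (c *: A + B) = c *: symmx A + symmx B.
Proof. exact: linearP. Qed.

Lemma symmx0 : symmx (0 : Sym K n) = 0. Proof. exact: linear0. Qed.
Lemma symmx_sum (I : Type) (r : seq I) (Q : pred I) (F : I -> Sym K n) :
  symmx (\sum_(l <- r | Q l) F l) = \sum_(l <- r | Q l) symmx (F l).
Proof. exact: linear_sum. Qed.
Lemma symmxZ c (A : Sym K n) : symmx (c *: A) = c *: symmx A.
Proof. exact: linearZ. Qed.

Definition entry i a b P : K := symmx (P i) a b.

Fact entry_scalar i a b : scalar (entry i a b).
Proof. by move=> c P Q; rewrite /entry !ffunE symmxP !mxE. Qed.
HB.instance Definition _ i a b :=
  GRing.isLinear.Build K E K *%R (entry i a b) (entry_scalar i a b).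

Lemma polydiff_entry i a b : polydiff (entry i a b) (fun _ => entry i a b).
Proof. exact: (polydiff_linear (entry i a b)). Qed.

(** The elements dual to the matrix entries: a symmetric matrix is the sum of
    its entries times symmetrized matrix units. *)
Definition sym_unit i a b : E :=
  [ffun j => if j == i then mksym (2^-1 *: (delta_mx a b + delta_mx b a)) else 0].

Lemma sym_unitE i a b j : symmx (sym_unit i a b j) =
  if j == i then 2^-1 *: (delta_mx a b + delta_mx b a) else 0.
Proof.
rewrite ffunE; case: eqP => _; last exact: symmx0.
by rewrite mksymK // linearZ /= linearD /= !trmx_delta addrC.
Qed.

Lemma sym_tuple_sum P :
  P = \sum_i \sum_a \sum_b symmx (P i) a b *: sym_unit i a b.
Proof.
apply/ffunP => j; apply: symmx_inj.
rewrite sum_ffunE symmx_sum (bigD1 j) //= [X in _ + X]big1 ?addr0 => [|i ij].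
  rewrite sum_ffunE symmx_sum.
  transitivity (2^-1 *: (symmx (P j) + (symmx (P j))^T)).
    rewrite symmx_tr -[X in _ *: (X + X)]scale1r -scalerDl scalerA.
    by rewrite mulVf ?scale1r // pnatr_eq0.
  rewrite {1 2}[symmx (P j)]matrix_sum_delta linear_sum -big_split scaler_sumr.
  apply: eq_bigr => a _ /=; rewrite sum_ffunE symmx_sum linear_sum -big_split.
  rewrite scaler_sumr; apply: eq_bigr => b _ /=.
  rewrite ffunE symmxZ sym_unitE eqxx linearZ /= trmx_delta -scalerDr.
  by rewrite !scalerA mulrC.
rewrite sum_ffunE symmx_sum big1 // => a _; rewrite sum_ffunE symmx_sum big1 // => b _.
by rewrite ffunE symmxZ sym_unitE eq_sym (negPf ij) scaler0.
Qed.

Lemma scalar_sym_sum (f : {scalar E}) P :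
  f P = \sum_i \sum_a \sum_b f (sym_unit i a b) * symmx (P i) a b.
Proof.
rewrite {1}[P]sym_tuple_sum linear_sum; apply: eq_bigr => i _.
rewrite linear_sum; apply: eq_bigr => a _; rewrite linear_sum.
by apply: eq_bigr => b _; rewrite linearZ /= mulrC.
Qed.

Lemma polyfun_entries (E' : vectType K) (f : {scalar E}) (c : E' -> E) :
  (forall i, polymx (fun t => symmx (c t i))) -> polyfun (fun t => f (c t)).
Proof.
move=> cP; apply: (@polyfun_ext _ _ (fun t =>
  \sum_i \sum_a \sum_b f (sym_unit i a b) * symmx (c t i) a b)).
  apply: polyfun_sum => i _; apply: polyfun_sum => a _; apply: polyfun_sum => b _.
  by apply: polyfunM; [apply: polyfunC|apply: cP].
by move=> t; rewrite [RHS]scalar_sym_sum.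
Qed.

Lemma germ_entries (f : {scalar E}) (c : K -> E) P V :
    (forall i a b, germ (fun t => symmx (c t i) a b) (symmx (P i) a b) (symmx (V i) a b)) ->
  germ (fun t => f (c t)) (f P) (f V).
Proof.
move=> cP; rewrite !(scalar_sym_sum f).
apply: (@germ_ext _ (fun t =>
  \sum_i \sum_a \sum_b f (sym_unit i a b) * symmx (c t i) a b)); last first.
  by move=> t; rewrite [RHS]scalar_sym_sum.
apply: germ_sum => i; apply: germ_sum => a; apply: germ_sum => b.
by have := germM (germC (f (sym_unit i a b))) (cP i a b); rewrite mul0r addr0.
Qed.

Definition trace_form (B P : E) : K := \sum_i \tr (symmx (B i) *m symmx (P i)).

Fact trace_form_scalar B : scalar (trace_form B).
Proof.
move=> c P Q; rewrite /trace_form mulr_sumr -big_split; apply: eq_bigr => i _.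
by rewrite !ffunE symmxP mulmxDr -scalemxAr linearP.
Qed.
HB.instance Definition _ B :=
  GRing.isLinear.Build K E K *%R (trace_form B) (trace_form_scalar B).

(** The tuple representing a linear form through the trace pairing. *)
Definition gradient (f : E -> K) : E :=
  [ffun i => mksym (\matrix_(a, b) f (sym_unit i a b))].

Lemma gradientE f i a b : symmx (gradient f i) a b = f (sym_unit i a b).
Proof.
rewrite ffunE mksymK ?mxE //; apply/matrixP => c d; rewrite !mxE.
congr f; apply/ffunP => j; apply: symmx_inj; rewrite !sym_unitE.
by case: ifP => // _; rewrite addrC.
Qed.

Lemma trace_form_entries B P :
  trace_form B P = \sum_i \sum_a \sum_b symmx (B i) a b * symmx (P i) a b.
Proof.
apply: eq_bigr => i _; apply: eq_bigr => a _; rewrite mxE; apply: eq_bigr => b _.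
by rewrite [symmx (P i) b a]symmxC.
Qed.

Lemma trace_form_gradient (f : {scalar E}) : trace_form (gradient f) =1 f.
Proof.
move=> P; rewrite trace_form_entries [RHS]scalar_sym_sum.
by do 3!(apply: eq_bigr => ? _); rewrite gradientE.
Qed.

Lemma gradient_trace_form B : gradient (trace_form B) = B.
Proof.
apply/ffunP => i; apply: symmx_inj; apply/matrixP => a b; rewrite gradientE.
rewrite /trace_form (bigD1 i) //= big1 ?addr0 => [|j ji]; last first.
  by rewrite sym_unitE (negPf ji) mulmx0 mxtrace0.
rewrite sym_unitE eqxx -scalemxAr mxtraceZ mulmxDr mxtraceD.
rewrite !mxtrace_mul_delta [symmx _ b a]symmxC -mulr2n -[X in _ * X]mulr_natl mulrA.
by rewrite mulVf ?mul1r // pnatr_eq0.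
Qed.

End SymTuples.

(** * Cayley charts of the Stiefel manifold *)

Section Cayley.
Context {K : numFieldType}.

(** The determinant is affine in each scaling factor and equals 1 when all
    factors vanish, so the factors can be moved to [1] or [-1] one at a time
    while keeping it nonzero. *)
Lemma sign_unitmx m (M : 'M[K]_m) :
  exists s : 'rV[K]_m, (forall i, s 0 i ^+ 2 = 1) /\ 1%:M + diag_mx s *m M \in unitmx.
Proof.
pose f (s : 'rV[K]_m) := \det (1%:M + diag_mx s *m M).
pose upd (s : 'rV[K]_m) i c : 'rV[K]_m := \row_j if j == i then c else s 0 j.
have fE s i c : f (upd s i c) =
    (1 + c) / 2 * f (upd s i 1) + (1 - c) / 2 * f (upd s i (-1)).
  apply: (determinant_multilinear (i0 := i)).
  - apply/rowP => j; rewrite !mul_diag_mx !mxE eqxx.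
    by case: (i == j); rewrite ?mulr1n ?mulr0n; field; rewrite ?pnatr_eq0.
  - apply/matrixP => a j.
    by rewrite !mul_diag_mx !mxE [_ == i]eq_sym (negPf (neq_lift _ _)).
  - apply/matrixP => a j.
    by rewrite !mul_diag_mx !mxE [_ == i]eq_sym (negPf (neq_lift _ _)).
have H r : (r <= m)%N ->
    exists s : 'rV[K]_m, (forall i : 'I_m, (i < r)%N -> s 0 i ^+ 2 = 1) /\ f s != 0.
  elim: r => [_|r IH rm].
    by exists 0; rewrite /f linear0 mul0mx addr0 det1 oner_neq0.
  have [s [s1 fs]] := IH (ltnW rm); pose i := Ordinal rm.
  have sE : s = upd s i (s 0 i).
    by apply/rowP => j; rewrite mxE; case: eqP => [->|].
  have [c c1 fc] : exists2 c, c ^+ 2 = 1 & f (upd s i c) != 0.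
    have [f1|f1] := eqVneq (f (upd s i 1)) 0; last by exists 1; rewrite ?expr1n.
    exists (-1); first by rewrite sqrrN expr1n.
    by apply: contraNneq fs => f2; rewrite sE fE f1 f2 !mulr0 addr0.
  exists (upd s i c); split=> // j; rewrite ltnS leq_eqVlt mxE => /orP[/eqP jr|jr].
    by rewrite (_ : j == i) //; apply/eqP/val_inj.
  by case: (j == i); [exact: c1|exact: s1 _ jr].
have [s [s1 fs]] := H m (leqnn m); exists s; split=> [i|]; first exact: s1.
by rewrite unitmxE unitfE.
Qed.

Lemma cayley_orthogonal n (S : 'M[K]_n) (Q := invmx (1%:M + S) *m (1%:M - S)) :
  S^T = - S -> 1%:M + S \in unitmx -> Q^T *m Q = 1%:M.
Proof.
move=> ST uS.
have S1T : (1%:M + S)^T = 1%:M - S by rewrite linearD /= trmx1 ST.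
have S2T : (1%:M - S)^T = 1%:M + S by rewrite linearB /= trmx1 ST opprK.
have uS' : 1%:M - S \in unitmx by rewrite -S1T unitmx_tr.
have comm : (1%:M + S) *m (1%:M - S) = (1%:M - S) *m (1%:M + S).
  by rewrite mulmxBr mulmxDr !mulmx1 !mulmxDl !mulNmx !mul1mx opprD !addrA addrK subrK.
rewrite /Q trmx_mul trmx_inv S1T S2T.
have -> : (1%:M + S) *m invmx (1%:M - S) = invmx (1%:M - S) *m (1%:M + S).
  by rewrite -[LHS](mulKmx uS') [X in _ *m X]mulmxA -comm mulmxK.
rewrite -!mulmxA [X in _ *m X]mulmxA mulmxV // mul1mx mulVmx //.
Qed.

Context {k n : nat} (kn : (k <= n)%N).
Local Notation J := (pid_mx k : 'M[K]_(n, k)).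

Lemma pid_isometry : J^T *m J = 1%:M.
Proof. by rewrite tr_pid_mx mul_pid_mx !minnn (minn_idPr kn) pid_mx_1. Qed.

(** Inverse Cayley transform of a frame: writing [W = (J + Z)U^-1] and
    [V = (J - Z)U^-1] with [U = 1 + J^T Z], the matrix [S] below is the skew
    matrix without lower right block that satisfies [S W = V]. *)
Lemma frame_cayley (Z : 'M[K]_(n, k)) :
    Z^T *m Z = 1%:M -> 1%:M + J^T *m Z \in unitmx ->
  exists S : 'M[K]_n, [/\ S^T = - S,
    forall a b : 'I_n, (k <= a)%N -> (k <= b)%N -> S a b = 0,
    1%:M + S \in unitmx & (1%:M + S) *m Z = (1%:M - S) *m J].
Proof.
move=> ZZ; set U := 1%:M + J^T *m Z => uU.
have JJ := pid_isometry.
pose W := (J + Z) *m invmx U; pose V := (J - Z) *m invmx U.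
have JW : J^T *m W = 1%:M by rewrite mulmxA mulmxDr JJ mulmxV.
have VW : V^T *m W = - (W^T *m V).
  have core : (J - Z)^T *m (J + Z) = - ((J + Z)^T *m (J - Z)).
    have -> : (J - Z)^T *m (J + Z) = J^T *m Z - Z^T *m J.
      rewrite [(J - Z)^T]linearB /= mulmxBl !mulmxDr JJ ZZ opprD addrA.
      by rewrite [1%:M + _]addrC addrAC addrK.
    rewrite [(J + Z)^T]linearD /= mulmxDl !mulmxBr JJ ZZ [_ + (_ - 1%:M)]addrC addrA subrK.
    by rewrite opprB.
  by rewrite !trmx_mul !mulmxA -[_ *m _ *m (J + Z)]mulmxA core mulmxN mulNmx mulmxA.
have WU : W *m U = J + Z by rewrite mulmxKV.
have VU : V *m U = J - Z by rewrite mulmxKV.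
clearbody V W.
pose S := V *m J^T - J *m V^T + J *m (V^T *m W) *m J^T.
have ST : S^T = - S.
  rewrite /S linearD linearB /= !trmx_mul !trmxK VW opprD opprB; congr (_ + _).
  by rewrite mulmxN mulNmx opprK !mulmxA.
have SW : S *m W = V.
  by rewrite /S !(mulmxDl, mulNmx) -!mulmxA JW !mulmx1 subrK.
have SZ : (1%:M + S) *m Z = (1%:M - S) *m J.
  have : S *m (J + Z) = J - Z.
    by rewrite -WU mulmxA SW.
  rewrite mulmxDr => /(canRL (addKr _)) e.
  by rewrite mulmxDl mulmxBl !mul1mx e [Z + _]addrC -addrA subrK addrC.
exists S; split=> // [a b ka kb|].
  have J0 m (M : 'M[K]_(m, k)) c : (M *m J^T) c b = 0.
    rewrite mxE big1 // => l _; rewrite !mxE.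
    by rewrite ltnNge kb andbF mulr0.
  have J0' m (M : 'M[K]_(k, m)) c : (J *m M) a c = 0.
    rewrite mxE big1 // => l _; rewrite !mxE.
    by rewrite ltnNge ka andbF mul0r.
  have addE (A B D : 'M[K]_n) : (A - B + D) a b = A a b - B a b + D a b.
    by rewrite !mxE.
  by rewrite /S addE !J0 J0' subrr addr0.
pose N := 1%:M - J *m J^T.
(* A right inverse of [1 + S]: it maps [H] to [J], and [N] to [N] up to a
   multiple of [J], while [1 = N + J J^T]. *)
have JN : J^T *m N = 0 by rewrite mulmxBr mulmx1 mulmxA JJ mul1mx subrr.
pose H := 2^-1 *: (J + Z).
have SH : (1%:M + S) *m H = J.
  rewrite -scalemxAr mulmxDr SZ -mulmxDl addrACA subrr addr0.
  by rewrite -raddfD mul_scalar_mx scalerA mulVf ?scale1r // pnatr_eq0.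
have SN : (1%:M + S) *m N = N - J *m (V^T *m N).
  rewrite mulmxDl mul1mx; congr (_ + _).
  by rewrite /S !(mulmxDl, mulNmx) -!mulmxA JN !mulmx0 addr0 add0r.
have NE : N + J *m J^T = 1%:M by rewrite subrK.
have : (1%:M + S) *m (H *m J^T + N + H *m (V^T *m N)) = 1%:M.
  clearbody N H; rewrite 2!mulmxDr SN [_ *m (H *m J^T)]mulmxA.
  by rewrite [_ *m (H *m _)]mulmxA SH addrA subrK addrC.
by case/mulmx1_unit.
Qed.

Lemma frame_orthogonal (Z : 'M[K]_(n, k)) :
    Z^T *m Z = 1%:M -> exists (s : 'rV[K]_k) (S : 'M[K]_n),
  [/\ forall i, s 0 i ^+ 2 = 1, S^T = - S,
    forall a b : 'I_n, (k <= a)%N -> (k <= b)%N -> S a b = 0,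
    1%:M + S \in unitmx & (1%:M + S) *m (Z *m diag_mx s) = (1%:M - S) *m J].
Proof.
move=> ZZ; have [s [s1 us]] := sign_unitmx (J^T *m Z)^T.
have ss : diag_mx s *m diag_mx s = 1%:M.
  rewrite mulmx_diag -[1%:M]diag_const_mx; congr diag_mx.
  by apply/rowP => j; rewrite !mxE -expr2 s1.
have [||S [? ? ? ?]] := frame_cayley (Z := Z *m diag_mx s).
- by rewrite trmx_mul tr_diag_mx -mulmxA [Z^T *m _]mulmxA ZZ mul1mx.
- by rewrite -unitmx_tr linearD /= trmx1 mulmxA trmx_mul tr_diag_mx.
by exists s, S; split.
Qed.

End Cayley.

(** * Flags of projections and orthonormal frames *)

Section Flags.
Context {K : numFieldType} {k n : nat}.
Local Notation E := {ffun 'I_k -> Sym K n}.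
Implicit Types (B P V : E) (i j : 'I_k).

(** [flag_ext P m] is the projection of rank [m] in the flag, with rank 0
    included; the increments [step P j] are then defined uniformly. *)
Definition flag_ext P (m : nat) : 'M[K]_n :=
  if m is m'.+1 then (if insub m' is Some i then symmx (P i) else 0) else 0.
Definition step P j : 'M[K]_n := flag_ext P j.+1 - flag_ext P j.

Lemma flag_extS P i : flag_ext P i.+1 = symmx (P i).
Proof. by rewrite /= valK. Qed.

Lemma flag_ext_tr P m : (flag_ext P m)^T = flag_ext P m.
Proof. by case: m => [|m] /=; rewrite ?trmx0 //; case: insubP => *; rewrite ?trmx0 ?symmx_tr. Qed.

Lemma sum_step P (m : nat) : (m <= k)%N ->
  \sum_(j < k | (j < m)%N) step P j = flag_ext P m.
Proof.
move=> mk; rewrite -(big_ord_widen k (fun l : nat => flag_ext P l.+1 - flag_ext P l)) //.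
rewrite -(big_mkord xpredT (fun l : nat => flag_ext P l.+1 - flag_ext P l)).
by rewrite telescope_sumr // subr0.
Qed.

(** Summation by parts. *)
Lemma abel_sum (B p : 'I_k -> 'M[K]_n) :
  \sum_i B i *m (\sum_(j < k | (j <= i)%N) p j) =
  \sum_(j < k) (\sum_(i < k | (j <= i)%N) B i) *m p j.
Proof.
under eq_bigr do rewrite mulmx_sumr big_mkcond.
rewrite exchange_big; apply: eq_bigr => j _.
by rewrite mulmx_suml [RHS]big_mkcond.
Qed.

Lemma abel_flag B P : \sum_i symmx (B i) *m symmx (P i) =
  \sum_(j < k) (\sum_(i < k | (j <= i)%N) symmx (B i)) *m step P j.
Proof.
rewrite -abel_sum; apply: eq_bigr => i _; congr (_ *m _).
by rewrite -flag_extS -sum_step.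
Qed.

Section OneFlag.
Context {P : E} (PP : pFl P).

Lemma flag_mul i j : (j <= i)%N ->
  symmx (P i) *m symmx (P j) = symmx (P j).
Proof. by have [H _] := PP; apply: H. Qed.

Lemma flag_ext_mul (m l : nat) : (l <= m)%N -> (m <= k)%N ->
  flag_ext P m *m flag_ext P l = flag_ext P l.
Proof.
case: l m => [|l] [|m] //; rewrite ?mulmx0 // => lm mk.
have lk : (l < k)%N by apply: leq_trans mk.
by rewrite -[m]/(val (Ordinal mk)) -[l]/(val (Ordinal lk)) !flag_extS flag_mul.
Qed.

Lemma flag_ext_mul_tr (m l : nat) : (l <= m)%N -> (m <= k)%N ->
  flag_ext P l *m flag_ext P m = flag_ext P l.
Proof.
move=> lm mk; rewrite -[RHS]flag_ext_tr -[in RHS](flag_ext_mul lm mk) trmx_mul.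
by rewrite !flag_ext_tr.
Qed.

Lemma step_tr j : (step P j)^T = step P j.
Proof. by rewrite linearB /= -/(flag_ext P j.+1) !flag_ext_tr. Qed.

Lemma step_ext j (m : nat) : (m <= k)%N ->
  flag_ext P m *m step P j = if (j < m)%N then step P j else 0.
Proof.
move=> mk; rewrite /step mulmxBr; case: ltnP => jm.
  by rewrite !flag_ext_mul // ltnW.
by rewrite !flag_ext_mul_tr ?subrr // ?(leq_trans jm) // ltnW // ltn_ord.
Qed.

Lemma step_mul i j : step P i *m step P j = if i == j then step P j else 0.
Proof.
rewrite {1}/step mulmxBl !step_ext ?(ltnW (ltn_ord i)) ?ltn_ord // ltnS.
rewrite -val_eqE /=; case: ltngtP => // ij.
- by rewrite subrr.
- by rewrite subr0.
- by rewrite subr0.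
Qed.

Lemma step_trace j : \tr (step P j) = 1.
Proof.
have tr_ext (m : nat) : (m <= k)%N -> \tr (flag_ext P m) = m%:R.
  case: m => [|m] mk; first by rewrite mxtrace0.
  by rewrite -[m]/(val (Ordinal mk)) flag_extS; have [_ ->] := PP.
rewrite linearB /= -/(flag_ext P j.+1) !tr_ext ?ltn_ord // ?(ltnW (ltn_ord j)) //.
by rewrite -natrB // subSnn.
Qed.

End OneFlag.

Definition frame_proj (Z : 'M[K]_(n, k)) (m : nat) : 'M[K]_n :=
  Z *m (pid_mx m : 'M_k) *m Z^T.

Lemma frame_proj_tr Z m : (frame_proj Z m)^T = frame_proj Z m.
Proof. by rewrite !trmx_mul trmxK tr_pid_mx mulmxA. Qed.

Lemma frame_proj_sum Z m :
  frame_proj Z m = \sum_(j < k | (j < m)%N) col j Z *m (col j Z)^T.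
Proof.
apply/matrixP => a b; rewrite mxE summxE [RHS]big_mkcond; apply: eq_bigr => j _.
rewrite mxE (bigD1 j) //= big1 ?addr0 => [|l lj].
  rewrite !mxE eqxx /=; case: ifP => _; last by rewrite mulr0 mul0r.
  by rewrite mulr1 big_ord1 !mxE.
by rewrite !mxE -val_eqE in lj *; rewrite (negPf lj) mulr0.
Qed.

Lemma frame_proj_pFl Z P : (k <= n)%N -> Z^T *m Z = 1%:M ->
  (forall i, symmx (P i) = frame_proj Z i.+1) -> pFl P.
Proof.
move=> kn ZZ PZ; split=> [i j ji|i]; rewrite !PZ /frame_proj.
  rewrite -!mulmxA [Z^T *m _]mulmxA ZZ mul1mx [X in _ *m X]mulmxA mul_pid_mx.
  by rewrite (minn_idPr (_ : j.+1 <= i.+1)%N) // (minn_idPr _) // ltn_ord.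
rewrite mxtrace_mulC mulmxA ZZ mul1mx /mxtrace.
transitivity (\sum_(a < k | (a < i.+1)%N) (1 : K)).
  by rewrite [RHS]big_mkcond; apply: eq_bigr => a _; rewrite mxE eqxx /=; case: ifP.
by rewrite -(big_ord_widen k (fun=> 1)) // sumr_const card_ord.
Qed.

End Flags.

Section Frames.
Context {C : numClosedFieldType} {k n : nat}.
Local Notation E := {ffun 'I_k -> Sym C n}.
Implicit Types (B P : E) (i j : 'I_k).

(** A projection of trace 1 has rank 1, and a symmetric matrix of rank 1 is
    [z z^T] up to a factor, which the square root absorbs. *)
Lemma symmetric_rank1 (p : 'M[C]_n) : p^T = p -> p *m p = p -> \tr p = 1 ->
  exists z : 'cV[C]_n, p = z *m z^T.
Proof.
move=> pT pp trp.
have [u [v [puv vu]]] : exists (u : 'cV[C]_n) (v : 'rV[C]_n), p = u *m v /\ v *m u = 1%:M.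
  have : exists r (u : 'M[C]_(n, r)) (v : 'M[C]_(r, n)), p = u *m v /\ v *m u = 1%:M.
    have uinj m := @row_full_inj _ _ _ m _ (col_base_full p).
    have vinj m := @row_free_inj _ m _ _ _ (row_base_free p).
    move: (mulmx_base p) uinj vinj.
    move: (col_base p) (row_base p) => u v uv uinj vinj.
    exists (\rank p), u, v; split=> //; apply: vinj; rewrite mul1mx; apply: uinj.
    by rewrite !mulmxA uv -mulmxA uv.
  move=> [r [u [v [puv vu]]]].
  have r1 : r = 1%N.
    apply/eqP; rewrite -(eqr_nat C); apply/eqP.
    by rewrite [RHS]mulr1n -[RHS]trp puv mxtrace_mulC vu mxtrace1.
  by subst r; exists u, v.
have pvu : p = v^T *m u^T by rewrite -trmx_mul -puv pT.
have uE : u = (u^T *m u) 0 0 *: v^T.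
  rewrite -[LHS]mulmx1 -vu mulmxA -puv pvu -mulmxA.
  by rewrite {1}[u^T *m u]mx11_scalar mul_mx_scalar.
exists (sqrtC ((u^T *m u) 0 0) *: v^T).
rewrite linearZ /= trmxK -scalemxAl -scalemxAr scalerA -expr2 sqrtCK.
by rewrite scalemxAl -uE.
Qed.

Lemma pFl_frame P : pFl P -> exists Z : 'M[C]_(n, k),
  Z^T *m Z = 1%:M /\ forall i, symmx (P i) = frame_proj Z i.+1.
Proof.
move=> PP.
have pE j : exists z : 'cV[C]_n, step P j = z *m z^T.
  apply: symmetric_rank1; rewrite ?step_tr ?(step_trace PP) //.
  by rewrite (step_mul PP) eqxx.
have [z zE] := choice pE.
pose Z := \matrix_(a < n, j < k) z j a 0.
have colZ j : col j Z = z j by apply/colP => a; rewrite !mxE.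
exists Z; split; last first.
  move=> i; rewrite -flag_extS -sum_step // frame_proj_sum.
  by apply: eq_bigr => j _; rewrite colZ.
apply/matrixP => i j; rewrite [RHS]mxE.
have -> : (Z^T *m Z) i j = ((z i)^T *m z j) 0 0.
  by rewrite !mxE; apply: eq_bigr => a _; rewrite !mxE.
have zz1 l : (z l)^T *m z l = 1%:M.
  rewrite [LHS]mx11_scalar -trace_mx11 mxtrace_mulC -zE.
  by rewrite (step_trace PP).
have [<-|ij] := eqVneq i j; first by rewrite zz1 mxE eqxx.
have := step_mul PP i j; rewrite (negPf ij) !zE => e.
have : (z i)^T *m (z i *m (z i)^T *m (z j *m (z j)^T)) *m z j = 0.
  by rewrite e mulmx0 mul0mx.
rewrite !mulmxA zz1 mul1mx -!mulmxA zz1 mulmx1 => ->.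
by rewrite mxE.
Qed.

Lemma frame_proj_sign (Z : 'M[C]_(n, k)) (s : 'rV[C]_k) (m : nat) :
  (forall i, s 0 i ^+ 2 = 1) -> frame_proj (Z *m diag_mx s) m = frame_proj Z m.
Proof.
move=> s1; rewrite !frame_proj_sum; apply: eq_bigr => j _.
apply/matrixP => a b; rewrite mul_mx_diag !mxE !big_ord1 !mxE.
by rewrite mulrACA -expr2 s1 mulr1.
Qed.

(** The flags at which [trace_form B] is stationary, see [critical_pFl]. *)
Definition stationary B : set E :=
  [set P | pFl P /\
    \sum_i (symmx (B i) *m symmx (P i) - symmx (P i) *m symmx (B i)) = 0].

(** * A rational parametrization of the stationary pairs *)

(** The parameter space is [E] itself.  The entries [t_b(a,b)] with [b < a]
    fill a skew matrix [S], hence through the Cayley transform [Q] a flag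
    [Q D_i Q^T].  The tuples stationary at the standard flag [D] are those with
    [\sum_(b <= i < a) C_i(a,b) = 0] for [b < a], and these equations express
    [C_b(a,b)] in terms of the remaining entries of [t].  So no entry of [t] is
    used twice, and stationary pairs have as many parameters as [B] has
    entries. *)
Definition chart_skew (t : E) : 'M[C]_n := \matrix_(a, b)
  if (b < a)%N then (if insub (val b) is Some i then symmx (t i) a b else 0)
  else if (a < b)%N then - (if insub (val a) is Some i then symmx (t i) a b else 0)
  else 0.

Definition chart_core (t : E) i : 'M[C]_n := \matrix_(a, b)
  if (a != b) && (minn a b == i)
  then - \sum_(j < k | (i < j)%N && (j < maxn a b)%N) symmx (t j) a b
  else symmx (t i) a b.

Definition chart_num (t : E) : 'M[C]_n :=
  \adj (1%:M + chart_skew t) *m (1%:M - chart_skew t).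
Definition chart_den (t : E) : C := \det (1%:M + chart_skew t) ^+ 2.
Definition chart_objective (t : E) : E :=
  [ffun i => mksym (chart_num t *m chart_core t i *m (chart_num t)^T)].
Definition chart_flag (t : E) : E :=
  [ffun i => mksym (chart_num t *m pid_mx (val i).+1 *m (chart_num t)^T)].

Lemma polyfun_entry i (a b : 'I_n) : polyfun (fun t : E => symmx (t i) a b).
Proof. exact: (polyfun_linear (entry i a b)). Qed.

Lemma polymx_chart_skew : polymx chart_skew.
Proof.
have H (a b c : 'I_n) : polyfun (fun t : E =>
    if insub (val c) is Some i then symmx (t i) a b else 0).
  by case: insubP => [i _ _|_]; [apply: polyfun_entry|apply: polyfunC].
move=> a b; apply: (@polyfun_ext _ _ (fun t : E =>
  if (b < a)%N then (if insub (val b) is Some i then symmx (t i) a b else 0)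
  else if (a < b)%N then - (if insub (val a) is Some i then symmx (t i) a b else 0)
  else 0)) => [|t]; last by rewrite mxE.
case: (b < a)%N; first exact: H.
case: (_ < _)%N; [exact/polyfunN/H|exact: polyfunC].
Qed.

Lemma polymx_chart_core i : polymx (fun t => chart_core t i).
Proof.
move=> a b; apply: (@polyfun_ext _ _ (fun t : E =>
  if (a != b) && (minn a b == i)
  then - \sum_(j < k | (i < j)%N && (j < maxn a b)%N) symmx (t j) a b
  else symmx (t i) a b)) => [|t]; last by rewrite mxE.
case: ((a != b) && (minn a b == i)); last exact: polyfun_entry.
by apply/polyfunN/polyfun_sum => j _; apply: polyfun_entry.
Qed.

Lemma polymx_chart_num : polymx chart_num.
Proof.
apply: polymxM.
  by apply/polymx_adj/polymxD; [apply: polymxC|apply: polymx_chart_skew].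
by apply: polymxD; [apply: polymxC|apply/polymxN/polymx_chart_skew].
Qed.

Lemma polyfun_chart_den : polyfun chart_den.
Proof.
by apply/polyfunX/polyfun_det/polymxD; [apply: polymxC|apply: polymx_chart_skew].
Qed.

Lemma chart_core_tr t i : (chart_core t i)^T = chart_core t i.
Proof.
apply/matrixP => a b; rewrite !mxE minnC maxnC [a == b]eq_sym.
by rewrite symmxC; case: ifP => // _; under eq_bigr do rewrite symmxC.
Qed.

Lemma conj_tr (Q M : 'M[C]_n) : M^T = M -> (Q *m M *m Q^T)^T = Q *m M *m Q^T.
Proof. by move=> MT; rewrite !trmx_mul trmxK MT mulmxA. Qed.

(** Flags do not see the signs of the frame vectors, so every flag has a frame
    in the Cayley chart. *)
Lemma chart_cover (kn : (k <= n)%N) B P : stationary B P ->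
  exists t, [/\ chart_den t != 0, chart_den t *: B = chart_objective t &
    chart_den t *: P = chart_flag t].
Proof.
move=> [PP BP]; have [Z [ZZ PZ]] := pFl_frame PP.
have [s [S [s1 ST Slr uS SZ]]] := frame_orthogonal kn ZZ.
pose Q := invmx (1%:M + S) *m (1%:M - S).
have QQ : Q^T *m Q = 1%:M by apply: cayley_orthogonal.
have QQ' : Q *m Q^T = 1%:M by apply: mulmx1C.
have PQ i : symmx (P i) = Q *m pid_mx i.+1 *m Q^T.
  have QJ : Q *m (pid_mx k : 'M_(n, k)) = Z *m diag_mx s.
    by rewrite -mulmxA -SZ mulKmx.
  have JpJ : (pid_mx k : 'M_(n, k)) *m pid_mx i.+1 *m (pid_mx k : 'M[C]_(k, n))
             = pid_mx i.+1.
    by rewrite !mul_pid_mx; congr pid_mx; have := ltn_ord i; lia.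
  rewrite PZ -(frame_proj_sign _ _ s1) /frame_proj -QJ trmx_mul tr_pid_mx.
  by rewrite -JpJ !mulmxA.
have QE : Q = invmx (1%:M + S) *m (1%:M - S) by [].
clearbody Q.
pose M i := Q^T *m symmx (B i) *m Q.
have MT i : (M i)^T = M i by rewrite /M !trmx_mul trmxK symmx_tr mulmxA.
have Msym i a b : M i a b = M i b a by rewrite -[in RHS]MT [RHS]mxE.
have BM i : symmx (B i) = Q *m M i *m Q^T.
  by rewrite /M !mulmxA QQ' mul1mx -mulmxA QQ' mulmx1.
have Mpid : \sum_i (M i *m pid_mx i.+1 - pid_mx i.+1 *m M i) = 0.
  transitivity (Q^T *m (\sum_i (symmx (B i) *m symmx (P i)
                                - symmx (P i) *m symmx (B i))) *m Q).
    rewrite mulmx_sumr mulmx_suml; apply: eq_bigr => i _.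
    rewrite mulmxBr mulmxBl !PQ /M -!mulmxA QQ mulmx1 !mulmxA QQ mul1mx.
    by rewrite -!mulmxA.
  by rewrite BP mulmx0 mul0mx.
clearbody M.
have M0 (a b : 'I_n) : (b < a)%N ->
    \sum_(i < k | (b <= i)%N && (i < a)%N) M i a b = 0.
  move=> ba; move/matrixP/(_ a b): Mpid; rewrite summxE mxE => e.
  rewrite -[RHS]e big_mkcond.
  apply: eq_bigr => i _; rewrite !mxE (bigD1 b) //= [X in _ = _ - X](bigD1 a) //=.
  rewrite !big1 ?addr0 => [|c ca|c cb].
  - rewrite !mxE !eqxx !ltnS /=; case: (leqP b i) => bi; case: (leqP a i) => ai /=.
    + by rewrite mulr1 mul1r subrr.
    + by rewrite mulr1 mul0r subr0.
    + by have := leq_trans ba (leq_trans ai (ltnW bi)); rewrite ltnn.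
    + by rewrite mulr0 mul0r subr0.
  - by rewrite !mxE -val_eqE in ca *; rewrite eq_sym (negPf ca) mul0r.
  - by rewrite !mxE -val_eqE in cb *; rewrite (negPf cb) mulr0.
(* The entries of [M b] that the linear equations determine make room for
   the skew matrix [S]. *)
pose t : E := [ffun i : 'I_k => mksym (\matrix_(a, b)
  if (a != b) && (minn a b == i)
  then (if (b < a)%N then S a b else S b a) else M i a b)].
have tE i a b : symmx (t i) a b = if (a != b) && (minn a b == i)
    then (if (b < a)%N then S a b else S b a) else M i a b.
  rewrite ffunE mksymK ?mxE //; apply/matrixP => c d; rewrite !mxE.
  rewrite minnC [d == c]eq_sym; case: eqP => [->|/eqP cd] //=.
  by case: ifP => // _; rewrite -val_eqE in cd; case: ltngtP cd.
have tS : chart_skew t = S.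
  apply/matrixP => a b; rewrite mxE.
  have Sab (c d : 'I_n) : S c d = - S d c.
    by have /matrixP/(_ d c) := ST; rewrite !mxE => <-; rewrite ?opprK.
  case: (ltngtP a b) => ab.
  - case: insubP => [i _ ia|]; last first.
      by rewrite -leqNgt oppr0 => ka; rewrite Slr // ltnW // (leq_ltn_trans ka).
    rewrite tE -val_eqE (ltn_eqF ab) /= ia (minn_idPl (ltnW ab)) eqxx ltnNge (ltnW ab) /=.
    by rewrite -Sab.
  - case: insubP => [i _ ib|]; last first.
      by rewrite -leqNgt => kb; rewrite Slr // ltnW // (leq_ltn_trans kb).
    by rewrite tE -val_eqE (gtn_eqF ab) /= ib (minn_idPr (ltnW ab)) eqxx ab.
  - have /val_inj -> := ab; have /eqP : S b b *+ 2 = 0 by rewrite mulr2n {1}Sab addNr.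
    by rewrite mulrn_eq0 /= => /eqP.
have tM i : chart_core t i = M i.
  have low (a b : 'I_n) : (b < a)%N -> chart_core t i a b = M i a b.
    move=> ba; rewrite mxE tE -val_eqE (gtn_eqF ba) /=.
    rewrite (minn_idPr (ltnW ba)) (maxn_idPl (ltnW ba)).
    case: eqP => // bi; have := M0 a b ba.
    rewrite (bigD1 i) /= -?bi ?leqnn // => /eqP; rewrite addr_eq0 => /eqP ->.
    congr (- _); apply: eq_big => j.
      by rewrite -val_eqE /= -bi; case: ltngtP => //=; rewrite ?andbF ?andbT.
    move=> /andP[bj ja]; rewrite tE -val_eqE (gtn_eqF ba) /= (minn_idPr (ltnW ba)).
    by rewrite (ltn_eqF bj).
  apply/matrixP => a b; have [ab|ba|/val_inj ->] := ltngtP a b.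
  - by rewrite -[in LHS]chart_core_tr mxE low.
  - exact: low.
  - by rewrite mxE tE eqxx.
have dS : \det (1%:M + S) != 0 by rewrite -unitfE -unitmxE.
have numE : chart_num t = \det (1%:M + S) *: Q.
  rewrite /chart_num tS QE /invmx uS -scalemxAl scalerA mulfV ?scale1r //.
have denE : chart_den t = \det (1%:M + S) ^+ 2 by rewrite /chart_den tS.
have scl M' : chart_num t *m M' *m (chart_num t)^T = chart_den t *: (Q *m M' *m Q^T).
  by rewrite numE denE linearZ /= -!scalemxAl -scalemxAr scalerA.
exists t; split; first by rewrite denE expf_neq0.
  apply/ffunP => i; apply: symmx_inj; rewrite !ffunE symmxZ mksymK; last first.
    exact/conj_tr/chart_core_tr.
  by rewrite scl tM -BM.
apply/ffunP => i; apply: symmx_inj; rewrite !ffunE symmxZ mksymK; last first.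
  by apply: conj_tr; rewrite tr_pid_mx.
by rewrite scl -PQ.
Qed.

Theorem stationary_generic_card : (k <= n)%N ->
  exists d, generic [set B : E | stationary B #= `I_d].
Proof.
move=> kn.
have [||M bounded] := generic_bounded _ _ polyfun_chart_den (chart_cover kn).
- move=> i; apply: polyfun_entries => j a b.
  have := polymxM (polymxM polymx_chart_num (polymx_chart_core j))
                  (polymx_tr polymx_chart_num).
  move=> /(_ a b)/polyfun_ext; apply=> t.
  by rewrite ffunE mksymK //; apply/conj_tr/chart_core_tr.
- move=> i; apply: polyfun_entries => j a b.
  have := polymxM (polymxM polymx_chart_num (polymxC (pid_mx (val j).+1)))
                  (polymx_tr polymx_chart_num).
  move=> /(_ a b)/polyfun_ext; apply=> t.
  by rewrite ffunE mksymK //; apply: conj_tr; rewrite tr_pid_mx.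
pose X := (('I_k * 'I_k * 'I_n * 'I_n) + ('I_k + 'I_n * 'I_n))%type.
pose g (x : X) (B P : E) : C := match x with
  | inl (i, j, a, b) => if (j <= i)%N
      then (symmx (P i) *m symmx (P j) - symmx (P j)) a b else 0
  | inr (inl i) => \tr (symmx (P i)) - i.+1%:R
  | inr (inr (a, b)) =>
      (\sum_i (symmx (B i) *m symmx (P i) - symmx (P i) *m symmx (B i))) a b
  end.
have bext (f h : E -> E -> C) : bipoly f -> (forall B P, f B P = h B P) -> bipoly h.
  by move=> fP e; rewrite (_ : h = f) //; apply/funext => B; apply/funext => P.
have bsum (Y : finType) (f : Y -> E -> E -> C) : (forall y, bipoly (f y)) ->
    bipoly (fun B P => \sum_y f y B P).
  by move=> /(bipoly_sum (index_enum _))[h hP hE]; apply: (bext _ _ hP).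
have bN f : bipoly f -> bipoly (fun B P => - f B P).
  by move=> fP; apply: (bext _ _ (BipolyM (BipolyC (-1)) fP)) => B P; ring.
have bL i a b : bipoly (fun B _ : E => symmx (B i) a b) by apply: (BipolyL (entry i a b)).
have bR i a b : bipoly (fun _ P : E => symmx (P i) a b) by apply: (BipolyR (entry i a b)).
apply: (@generic_card _ _ X g stationary M _ _ bounded).
  case=> [[[[i j] a] b]|[i|[a b]]]; rewrite /g /=.
  - case: (j <= i)%N; last exact: (BipolyC 0).
    apply: (bext _ _ (BipolyD (bsum _ _ (fun c => BipolyM (bR i a c) (bR j c b)))
                              (bN _ (bR j a b)))) => B P.
    by rewrite !mxE.
  - exact: BipolyD (bsum _ _ (fun a => bR i a a)) (bN _ (BipolyC _)).
  - apply: (bext _ _ (bsum _ _ (fun i => BipolyD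
       (bsum _ _ (fun c => BipolyM (bL i a c) (bR i c b)))
       (bN _ (bsum _ _ (fun c => BipolyM (bR i a c) (bL i c b))))))) => B P.
    by rewrite summxE; apply: eq_bigr => i _; rewrite !mxE.
move=> B P; split=> [[[P1 P2] P3] [[[[i j] a] b]|[i|[a b]]] /=|H].
- by case: ifP => // /P1 ->; rewrite subrr mxE.
- by rewrite P2 subrr.
- by rewrite P3 mxE.
split; [split=> [i j ji|i]|].
- apply/eqP; rewrite -subr_eq0; apply/eqP/matrixP => a b.
  by have := H (inl (i, j, a, b)); rewrite /g /= ji => ->; rewrite mxE.
- by apply/eqP; rewrite -subr_eq0; apply/eqP; have := H (inr (inl i)).
- by apply/matrixP => a b; have := H (inr (inr (a, b))); rewrite mxE.
Qed.

End Frames.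

(** * Critical points *)

Section Rotations.
Context {K : numFieldType}.

Lemma skew_trace_sym n (M : 'M[K]_n) :
  (forall W : 'M[K]_n, W^T = - W -> \tr (W *m M) = 0) -> M^T = M.
Proof.
move=> H; apply/matrixP => a b; rewrite mxE.
have := H (delta_mx a b - delta_mx b a).
rewrite mxtrace_mulC mulmxBr [\tr _]raddfB /= !mxtrace_mul_delta => e.
by apply/eqP; rewrite -subr_eq0 e // raddfB /= !trmx_delta opprB.
Qed.

Definition germmx m n (A : K -> 'M[K]_(m, n)) (A0 A1 : 'M[K]_(m, n)) :=
  forall i j, germ (fun t => A t i j) (A0 i j) (A1 i j).

Lemma germmxC m n (A : 'M[K]_(m, n)) : germmx (fun=> A) A 0.
Proof. by move=> i j; rewrite mxE; apply: germC. Qed.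

Lemma germmxM m n r (A : K -> 'M[K]_(m, n)) (B : K -> 'M[K]_(n, r)) A0 A1 B0 B1 :
  germmx A A0 A1 -> germmx B B0 B1 ->
  germmx (fun t => A t *m B t) (A0 *m B0) (A0 *m B1 + A1 *m B0).
Proof.
move=> AP BP i j; rewrite !mxE -big_split.
apply: (germ_ext (germ_sum _ (fun l => germM (AP i l) (BP l j)))) => t.
by rewrite mxE.
Qed.

Lemma germmx_tr m n (A : K -> 'M[K]_(m, n)) A0 A1 :
  germmx A A0 A1 -> germmx (fun t => (A t)^T) A0^T A1^T.
Proof. by move=> AP i j; rewrite !mxE; apply: (germ_ext (AP j i)) => t; rewrite mxE. Qed.

(** The Cayley transform of [t S] with [S = - W / 2] is orthogonal and equals
    [1 - 2 t S + 2 t^2 S^2 (1 + t S)^-1], so it leaves the identity with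
    velocity [W]. *)
Lemma rotation_curve n (W : 'M[K]_n) : W^T = - W ->
  exists (Q : K -> 'M[K]_n) (q : {poly K}), [/\ q.[0] != 0,
    forall t, q.[t] != 0 -> (Q t)^T *m Q t = 1%:M & germmx Q 1%:M W].
Proof.
move=> WT; pose S := - (2^-1 *: W).
have ST : S^T = - S by rewrite /S linearN linearZ /= WT scalerN.
pose A : 'M[{poly K}]_n := 1%:M + 'X *: map_mx polyC S.
have AE t : map_mx (horner_eval t) A = 1%:M + t *: S.
  by apply/matrixP => i j; rewrite !mxE /horner_eval !(hornerE, hornerMn).
have detE t : (\det A).[t] = \det (1%:M + t *: S).
  by rewrite -AE det_map_mx.
pose Q t := invmx (1%:M + t *: S) *m (1%:M - t *: S).
have unitA t : (\det A).[t] != 0 -> 1%:M + t *: S \in unitmx.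
  by rewrite detE unitmxE unitfE.
exists Q, (\det A); split.
- by rewrite detE scale0r addr0 det1 oner_neq0.
- by move=> t /unitA uA; apply: cayley_orthogonal => //; rewrite linearZ /= ST scalerN.
move=> i j; exists ((map_mx polyC (2 *: (S *m S)) *m \adj A) i j), (\det A).
rewrite detE scale0r addr0 det1 oner_neq0; split=> // t qt; have uA := unitA t qt.
pose R := invmx (1%:M + t *: S).
have RE : R = 1%:M - t *: (S *m R).
  by apply/eqP; rewrite eq_sym subr_eq -[X in _ == X + _]mul1mx scalemxAl -mulmxDl mulmxV.
have RE' : t *: (R *m S) = 1%:M - R.
  by apply/eqP; rewrite eq_sym subr_eq addrC -[X in _ == X + _]mulmx1 scalemxAr -mulmxDr mulVmx.
have RS : R = 1%:M - t *: S + t ^+ 2 *: (S *m S *m R).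
  rewrite {1}RE {1}RE mulmxBr mulmx1 scalerBr opprB addrA addrAC.
  by rewrite -scalemxAr scalerA -expr2 mulmxA.
have QE : Q t = R + R - 1%:M.
  by rewrite /Q -/R mulmxBr mulmx1 -scalemxAr RE' opprB addrA.
have mapSS : map_mx (horner_eval t) (map_mx polyC (2 *: (S *m S))) = 2 *: (S *m S).
  by apply/matrixP => a b; rewrite !mxE /horner_eval hornerC.
have num : ((map_mx polyC (2 *: (S *m S)) *m \adj A) i j).[t] / (\det A).[t] =
    2 * (S *m S *m R) i j.
  transitivity ((2 *: (S *m S) *m R) i j); last by rewrite -scalemxAl [LHS]mxE.
  rewrite /R /invmx uA -scalemxAr [RHS]mxE -detE mulrC; congr (_ * _).
  by rewrite -[in RHS]mapSS -AE -map_mx_adj -map_mxM [RHS]mxE.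
have WS : W i j = - 2 * S i j by rewrite !mxE; field; rewrite ?pnatr_eq0.
have QR : Q t i j = 2 * R i j - (1%:M : 'M[K]_n) i j.
  by rewrite QE [LHS]mxE [X in X + _]mxE [X in _ + X]mxE mulr_natl mulr2n.
have Rij : R i j = (1%:M : 'M[K]_n) i j - t * S i j + t ^+ 2 * (S *m S *m R) i j.
  rewrite {1}RS [LHS]mxE [X in X + _]mxE [X in _ + X]mxE; congr (_ + _ + _).
  by rewrite [LHS]mxE [X in - X]mxE.
by rewrite num WS QR Rij; ring.
Qed.

End Rotations.

Section CriticalFlags.
Context {C : numClosedFieldType} {k n : nat}.
Local Notation E := {ffun 'I_k -> Sym C n}.
Implicit Types (B P V : E) (i j : 'I_k).

Lemma tangent_pFl P V (W : 'M[C]_n) : pFl P -> W^T = - W ->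
    (forall i, symmx (V i) = W *m symmx (P i) - symmx (P i) *m W) ->
  tangent (@pFl C k n) P V.
Proof.
move=> [P1 P2] WT VE; have [Q [q [q0 QQ Qg]]] := rotation_curve WT.
pose c t : E := [ffun i => mksym (Q t *m symmx (P i) *m (Q t)^T)].
have cE t i : symmx (c t i) = Q t *m symmx (P i) *m (Q t)^T.
  by rewrite ffunE mksymK // conj_tr // symmx_tr.
apply: (tangent_curve (c := c) q0) => [t qt|l].
  split=> [i j ji|i]; rewrite !cE.
    by rewrite -!mulmxA [(Q t)^T *m (_ *m _)]mulmxA QQ // mul1mx [symmx (P i) *m _]mulmxA P1.
  by rewrite mxtrace_mulC mulmxA QQ // mul1mx P2.
apply: germ_entries => i a b.
have := germmxM (germmxM Qg (germmxC (symmx (P i)))) (germmx_tr Qg).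
move=> /(_ a b); rewrite trmx1 !mulmx1 mul1mx mulmx0 add0r WT mulmxN addrC -VE.
by move=> H; apply: (germ_ext H) => t; rewrite cE.
Qed.

(** Differentiating the equations [P_i P_j = P_j] of the flag variety. *)
Lemma tangent_pFl_mul P V i j : tangent (@pFl C k n) P V -> (j <= i)%N ->
  symmx (V i) *m symmx (P j) + symmx (P i) *m symmx (V j) = symmx (V j).
Proof.
move=> VT ji; apply/matrixP => a b; apply/eqP; rewrite -subr_eq0; apply/eqP.
have [F [Ff Fd]] : polydiff
    (fun P : E => \sum_c entry i a c P * entry j c b P + (-1) * entry j a b P)
    (fun P V => \sum_c (entry i a c V * entry j c b P + entry i a c P * entry j c b V)
                + (0 * entry j a b P + (-1) * entry j a b V)).
  apply: polydiffD.
    by apply: polydiff_sum => c; apply: polydiffM; apply: polydiff_entry.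
  by apply: polydiffM; [apply: polydiffC|apply: polydiff_entry].
have FW P' : pFl P' -> peval F P' = 0.
  move=> [P1 _]; rewrite Ff.
  have /matrixP/(_ a b) := P1 i j ji; rewrite mxE /entry => ->; ring.
have := VT F FW; rewrite Fd big_split /= !mxE /entry => e.
by rewrite -[RHS]e; ring.
Qed.

Lemma tangent_flag_ext P V (m l : nat) : tangent (@pFl C k n) P V ->
    (l <= m)%N -> (m <= k)%N ->
  flag_ext V m *m flag_ext P l + flag_ext P m *m flag_ext V l = flag_ext V l.
Proof.
move=> VT; case: l m => [|l] [|m] //; rewrite ?mulmx0 ?addr0 // => lm mk.
have lk : (l < k)%N by apply: leq_trans mk.
rewrite -[m]/(val (Ordinal mk)) -[l]/(val (Ordinal lk)) !flag_extS.
exact: tangent_pFl_mul.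
Qed.

Lemma mulmx_regroup (a b c d e f g h : 'M[C]_n) :
  a - b - (c - d) + (e - f - (g - h)) = (a + e) - (b + f) - (g + c) + (d + h).
Proof. by apply/matrixP => i j; rewrite !mxE; ring. Qed.

Lemma tangent_step P V j : tangent (@pFl C k n) P V ->
  step V j *m step P j + step P j *m step V j = step V j.
Proof.
move=> VT; have ext := tangent_flag_ext VT.
have ext_tr (m l : nat) : (l <= m)%N -> (m <= k)%N ->
    flag_ext P l *m flag_ext V m + flag_ext V l *m flag_ext P m = flag_ext V l.
  move=> lm mk; rewrite -[RHS]flag_ext_tr -[in RHS](ext _ _ lm mk) linearD /=.
  by rewrite !trmx_mul !flag_ext_tr.
have jk := ltn_ord j; have jk' := ltnW jk; rewrite /step.
move: (flag_ext V j.+1) (flag_ext P j.+1) (ext _ _ (leqnn j.+1) jk)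
  (ext _ _ (leqnSn j) jk) (ext_tr _ _ (leqnSn j) jk) => V' P' e1 e2 e3.
rewrite !(mulmxBl, mulmxBr) mulmx_regroup e1 e2 e3 ext //.
by rewrite -addrA addNr addr0.
Qed.

(** Testing the form on velocities of rotations shows that critical points are
    stationary.  Conversely, if [P] is stationary, write [A_j] for the sum of the [B_i] with [j <= i], [p_j] and
    [v_j] for the increments of [P] and of the tangent vector [V].  Then
    [X = \sum A_j p_j] is symmetric and [v_j = v_j p_j + p_j v_j], so that
    [\sum tr (A_j v_j) = 2 tr (X \sum p_j v_j) = tr (X V_k)], which vanishes
    because [X] is supported on the image of [P_k] and [V_k] exchanges that
    image with its complement. *)
Theorem critical_pFl B :
  critical (@pFl C k n) (trace_form B) = stationary B.
Proof.
rewrite (criticalE _ (polydiff_linear (trace_form B))).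
apply/seteqP; split=> P [PP PB]; split=> //.
  pose M := \sum_i symmx (P i) *m symmx (B i).
  have MT : M^T = \sum_i symmx (B i) *m symmx (P i).
    by rewrite linear_sum; apply: eq_bigr => i _; rewrite /= trmx_mul !symmx_tr.
  rewrite sumrB -MT; apply/eqP; rewrite subr_eq0; apply/eqP.
  apply: skew_trace_sym => W WT.
  pose V : E := [ffun i => mksym (W *m symmx (P i) - symmx (P i) *m W)].
  have VE i : symmx (V i) = W *m symmx (P i) - symmx (P i) *m W.
    rewrite ffunE mksymK // linearB /= !trmx_mul symmx_tr WT mulmxN mulNmx.
    by rewrite opprK addrC.
  have := PB V (tangent_pFl PP WT VE); rewrite /= /trace_form.
  have -> : \sum_i \tr (symmx (B i) *m symmx (V i)) = \tr (W *m M) - \tr (W *m M^T).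
    rewrite MT !mulmx_sumr !linear_sum -sumrB; apply: eq_bigr => i _ /=.
    rewrite VE mulmxBr linearB /=; congr (_ - _).
      by rewrite mxtrace_mulC -mulmxA.
    by rewrite mulmxA mxtrace_mulC.
  rewrite -[X in _ - X]mxtrace_tr trmx_mul trmxK WT mulmxN linearN /= opprK.
  rewrite [X in _ + X]mxtrace_mulC -mulr2n => /eqP.
  by rewrite mulrn_eq0 => /eqP.
move=> V VT; rewrite /trace_form.
pose A j := \sum_(i < k | (j <= i)%N) symmx (B i).
pose X := \sum_i symmx (B i) *m symmx (P i).
have AT j : (A j)^T = A j.
  by rewrite linear_sum; apply: eq_bigr => i _; apply: symmx_tr.
have XT : X^T = X.
  apply/eqP; rewrite eq_sym -subr_eq0 -[X in _ == X]PB sumrB; apply/eqP.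
  congr (_ - _); rewrite linear_sum; apply: eq_bigr => i _ /=.
  by rewrite trmx_mul !symmx_tr.
have XA : X = \sum_j A j *m step P j by apply: abel_flag.
have Xp j : X *m step P j = A j *m step P j.
  rewrite XA mulmx_suml (bigD1 j) //= big1 ?addr0 => [|i ij].
    by rewrite -mulmxA step_mul // eqxx.
  by rewrite -mulmxA step_mul // (negPf ij) mulmx0.
pose Y := \sum_j step P j *m step V j.
have stepVT j : (step V j)^T = step V j.
  by rewrite linearB /= -/(flag_ext V j.+1) !flag_ext_tr.
have YY : Y + Y^T = flag_ext V k.
  rewrite -sum_step // linear_sum -big_split [RHS]big_mkcond; apply: eq_bigr => j _ /=.
  by rewrite ltn_ord trmx_mul stepVT step_tr addrC tangent_step.
have XP : X *m flag_ext P k = X.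
  rewrite XA mulmx_suml; apply: eq_bigr => j _; rewrite -mulmxA; congr (_ *m _).
  apply: trmx_inj; rewrite trmx_mul step_tr flag_ext_tr.
  by rewrite (step_ext PP) // ltn_ord.
have PX : flag_ext P k *m X = X by rewrite -[RHS]XT -[in RHS]XP trmx_mul XT flag_ext_tr.
have XV : \tr (X *m flag_ext V k) = 0.
  have e := tangent_flag_ext VT (leqnn k) (leqnn k).
  have : \tr (X *m flag_ext V k) = \tr (X *m flag_ext V k) + \tr (X *m flag_ext V k).
    rewrite -{1}e mulmxDr mxtraceD; congr (_ + _); last by rewrite mulmxA XP.
    by rewrite mulmxA mxtrace_mulC mulmxA PX.
  by move/eqP; rewrite -subr_eq0 opprD addrA subrr add0r oppr_eq0 => /eqP.
have XY : \tr (X *m Y) = \tr (X *m Y^T).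
  by rewrite -[LHS]mxtrace_tr trmx_mul XT mxtrace_mulC.
transitivity (\tr (\sum_i symmx (B i) *m symmx (V i))); first by rewrite linear_sum.
rewrite abel_flag linear_sum /=.
transitivity (\sum_j (\tr (X *m (step P j *m step V j)) + \tr (X *m (step P j *m step V j)))).
  apply: eq_bigr => j _; rewrite -/(A j) -{1}(tangent_step j VT) mulmxDr mxtraceD.
  congr (_ + _); last by rewrite !mulmxA Xp.
  rewrite -[LHS]mxtrace_tr !trmx_mul AT stepVT step_tr mulmxA Xp.
  by rewrite mxtrace_mulC mulmxA.
have XYE : \tr (X *m Y) = \sum_j \tr (X *m (step P j *m step V j)).
  by rewrite mulmx_sumr linear_sum.
rewrite big_split /= -XYE {2}XY.
by rewrite -mxtraceD -mulmxDr YY.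
Qed.

End CriticalFlags.

Section CriticalFrames.
Context {C : numClosedFieldType} {k n : nat}.
Local Notation E := {ffun 'I_k -> Sym C n}.
Local Notation M := 'M[C]_(n, k).
Implicit Types (A : 'I_k -> 'M[C]_n) (Z W : M) (B P : E) (i j : 'I_k).

Definition mx_entry (a : 'I_n) i Z : C := Z a i.

Fact mx_entry_scalar a i : scalar (mx_entry a i).
Proof. by move=> c Z W; rewrite /mx_entry !mxE. Qed.
HB.instance Definition _ a i :=
  GRing.isLinear.Build C M C *%R (mx_entry a i) (mx_entry_scalar a i).

Lemma polydiff_mx_entry a i : polydiff (mx_entry a i) (fun _ => mx_entry a i).
Proof. exact: (polydiff_linear (mx_entry a i)). Qed.

Definition frame_objective A Z : C :=
  \sum_i ((col i Z)^T *m A i *m col i Z) 0 0.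

Lemma polydiff_frame_objective A : polydiff (frame_objective A) (fun Z W =>
  \sum_i (((col i W)^T *m A i *m col i Z) 0 0 + ((col i Z)^T *m A i *m col i W) 0 0)).
Proof.
have H : polydiff
    (fun Z => \sum_i \sum_c (\sum_a mx_entry a i Z * A i a c) * mx_entry c i Z)
    (fun Z W => \sum_i \sum_c
      ((\sum_a (mx_entry a i W * A i a c + mx_entry a i Z * 0)) * mx_entry c i Z
       + (\sum_a mx_entry a i Z * A i a c) * mx_entry c i W)).
  apply: polydiff_sum => i; apply: polydiff_sum => c.
  apply: polydiffM; last exact: polydiff_mx_entry.
  apply: polydiff_sum => a; apply: polydiffM; first exact: polydiff_mx_entry.
  exact: polydiffC.
have E1 Z W i : ((col i Z)^T *m A i *m col i W) 0 0 =
    \sum_c (\sum_a mx_entry a i Z * A i a c) * mx_entry c i W.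
  rewrite mxE; apply: eq_bigr => c _; rewrite !mxE; congr (_ * _).
  by apply: eq_bigr => a _; rewrite !mxE.
apply: (polydiff_ext H) => [Z|Z W]; apply: eq_bigr => i _; rewrite !E1 //.
rewrite -big_split; apply: eq_bigr => c _; congr (_ * _ + _).
by apply: eq_bigr => a _; rewrite mulr0 addr0.
Qed.

Lemma tangent_stiefel Z (W : 'M[C]_n) : stiefel Z -> W^T = - W ->
  tangent (@stiefel C k n) Z (W *m Z).
Proof.
rewrite /stiefel /= => ZZ WT; have [Q [q [q0 QQ Qg]]] := rotation_curve WT.
apply: (tangent_curve (c := fun t => Q t *m Z) q0) => [t qt|l].
  by rewrite /stiefel /= trmx_mul -mulmxA [(Q t)^T *m _]mulmxA QQ // mul1mx.
have fE (f : {scalar M}) Z' : f Z' = \sum_a \sum_j f (delta_mx a j) * Z' a j.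
  rewrite {1}[Z']matrix_sum_delta linear_sum; apply: eq_bigr => a _.
  by rewrite linear_sum; apply: eq_bigr => j _; rewrite linearZ /= mulrC.
have := germmxM Qg (germmxC Z); rewrite mul1mx mulmx0 add0r => g.
rewrite (fE (coord (vbasis {:M}) l) Z) (fE (coord (vbasis {:M}) l) (W *m Z)).
apply: (@germ_ext _ (fun t => \sum_a \sum_j
    coord (vbasis {:M}) l (delta_mx a j) * (Q t *m Z) a j)); last first.
  by move=> t; rewrite [RHS](fE (coord (vbasis {:M}) l)).
apply: germ_sum => a; apply: germ_sum => j.
have := germM (germC (coord (vbasis {:M}) l (delta_mx a j))) (g a j).
by rewrite mul0r addr0.
Qed.

Lemma critical_stiefel A Z : (forall i, (A i)^T = A i) ->
    critical (@stiefel C k n) (frame_objective A) Z ->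
  Z^T *m Z = 1%:M /\
  \sum_i (A i *m (col i Z *m (col i Z)^T) - col i Z *m (col i Z)^T *m A i) = 0.
Proof.
move=> AT; rewrite (criticalE _ (polydiff_frame_objective A)) => -[ZZ ZA].
split=> //; pose Y := \sum_i col i Z *m (col i Z)^T *m A i.
have YT : Y^T = \sum_i A i *m (col i Z *m (col i Z)^T).
  by rewrite linear_sum; apply: eq_bigr => i _; rewrite /= !trmx_mul trmxK AT.
rewrite sumrB -YT; apply/eqP; rewrite subr_eq0; apply/eqP.
apply: skew_trace_sym => W WT.
have : \sum_i (\tr (W *m (col i Z *m (col i Z)^T *m A i)) +
               \tr (W *m (col i Z *m (col i Z)^T *m A i))) = 0.
  rewrite -[RHS](ZA _ (tangent_stiefel ZZ WT)); apply: eq_bigr => i _.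
  have colW : col i (W *m Z) = W *m col i Z by rewrite !colE mulmxA.
  have e : ((col i Z)^T *m A i *m (W *m col i Z)) 0 0 =
      \tr (W *m (col i Z *m (col i Z)^T *m A i)).
    by rewrite -trace_mx11 mxtrace_mulC !mulmxA.
  rewrite colW e; congr (_ + _); rewrite -e -!trace_mx11 -[RHS]mxtrace_tr.
  by rewrite !trmx_mul !trmxK AT mulmxA.
rewrite big_split /= -(linear_sum (@mxtrace C n)) -mulmx_sumr -mulr2n => /eqP.
by rewrite mulrn_eq0 => /eqP.
Qed.

Lemma frame_stationary A B P Z :
    (k <= n)%N -> Z^T *m Z = 1%:M ->
    (forall j, \sum_(i < k | (j <= i)%N) symmx (B i) = A j) ->
    \sum_i (A i *m (col i Z *m (col i Z)^T) - col i Z *m (col i Z)^T *m A i) = 0 ->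
    (forall i, symmx (P i) = frame_proj Z i.+1) ->
  stationary B P.
Proof.
move=> kn ZZ BA ZA PZ; split; first exact: frame_proj_pFl PZ.
have AT i : (A i)^T = A i.
  by rewrite -BA linear_sum; apply: eq_bigr => j _; apply: symmx_tr.
have BP : \sum_i symmx (B i) *m symmx (P i) =
    \sum_i A i *m (col i Z *m (col i Z)^T).
  under [RHS]eq_bigr do rewrite -BA.
  by rewrite -abel_sum; apply: eq_bigr => i _; rewrite PZ frame_proj_sum.
rewrite -[RHS]ZA !sumrB BP; congr (_ - _); apply: trmx_inj.
rewrite !linear_sum /=; transitivity (\sum_i symmx (B i) *m symmx (P i)).
  by apply: eq_bigr => i _; rewrite trmx_mul !symmx_tr.
by rewrite BP; apply: eq_bigr => i _; rewrite !trmx_mul trmxK AT.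
Qed.

(** The rank 1 projection [z z^T] determines the squares of the entries of
    [z]. *)
Lemma finite_frames P :
  finite_set [set Z : M | forall i, symmx (P i) = frame_proj Z i.+1].
Proof.
pose r j (a : 'I_n) := sqrtC (step P j a a).
pose h (s : {ffun 'I_n * 'I_k -> bool}) : M :=
  \matrix_(a, j) ((-1) ^+ s (a, j) * r j a).
apply: (@sub_finite_set _ _ (h @` setT)); last first.
  by apply: finite_image; apply: finite_finset.
move=> Z /= PZ.
have stepE j : step P j = col j Z *m (col j Z)^T.
  have ext (m : nat) : (m <= k)%N -> flag_ext P m = frame_proj Z m.
    case: m => [|m] mk; first by rewrite /frame_proj pid_mx_0 mulmx0 mul0mx.
    by rewrite -[m]/(val (Ordinal mk)) flag_extS PZ.
  rewrite /step !ext // ?ltn_ord ?(ltnW (ltn_ord j)) // !frame_proj_sum.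
  rewrite (bigD1 j) //= [X in _ + X - _](eq_bigl (fun l : 'I_k => (l < j)%N)).
    by rewrite addrK.
  by move=> l; rewrite -val_eqE /= ltnS; case: ltngtP.
have sq a j : Z a j ^+ 2 = r j a ^+ 2.
  by rewrite /r sqrtCK stepE !mxE big_ord1 !mxE expr2.
exists [ffun aj => Z aj.1 aj.2 != r aj.2 aj.1] => //.
apply/matrixP => a j; rewrite mxE ffunE /=.
have /eqP := sq a j; rewrite eqf_sqr; case: eqP => [->|_ /eqP ->] /=.
  by rewrite expr0 mul1r.
by rewrite expr1 mulN1r.
Qed.

End CriticalFrames.

(** * Parameter spaces *)

Section ConsecutiveDifferences.
Context {V : zmodType} {k : nat}.
Implicit Types A B : 'I_k -> V.

Lemma sum_consecutive_diff A (j : 'I_k) :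
  \sum_(i < k | (j <= i)%N) consecutive_diff A i = A j.
Proof.
pose f (m : nat) : V := if insub m is Some i then A i else 0.
have fE (i : 'I_k) : f i = A i by rewrite /f valK.
have dE (i : 'I_k) : consecutive_diff A i = - (f i.+1 - f i).
  rewrite opprB fE /consecutive_diff /f.
  by case: insub => [j'|]; rewrite ?subr0.
transitivity (\sum_(j <= i < k) - (f i.+1 - f i)).
  rewrite big_geq_mkord; apply: eq_big => [i|i _]; first by rewrite ?andTb.
  exact: dE.
have jk := ltnW (ltn_ord j); rewrite sumrN telescope_sumr // opprB -fE.
by rewrite [f k]/f insubF ?ltnn // subr0.
Qed.

Lemma consecutive_diff_sum B (i : 'I_k) :
  consecutive_diff (fun j : 'I_k => \sum_(l < k | (j <= l)%N) B l) i = B i.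
Proof.
have split_i : \sum_(l < k | (i <= l)%N) B l = B i + \sum_(l < k | (i < l)%N) B l.
  rewrite (bigD1 i) //=; congr (_ + _); apply: eq_bigl => l.
  by rewrite -val_eqE /= ltn_neqAle andbC eq_sym.
rewrite /consecutive_diff; case: insubP => [j _ ji|].
  by rewrite split_i ji addrK.
rewrite -leqNgt => ki; rewrite split_i big_pred0 ?addr0 // => l.
by apply/negbTE; rewrite -leqNgt -ltnS (leq_trans (ltn_ord l)).
Qed.

Lemma consecutive_diff_ext A B : A =1 B -> consecutive_diff A =1 consecutive_diff B.
Proof. by move=> AB i; rewrite /consecutive_diff AB; case: insub => // j; rewrite AB. Qed.

End ConsecutiveDifferences.

Section Pullback.

Lemma generic_pullback (K : numFieldType) (E E' : vectType K) (h : E' -> E)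
    (P : set E) :
    (forall i, polyfun (fun x => coord (vbasis {:E}) i (h x))) ->
    (forall x, exists y, h y = x) -> generic P ->
  generic (h @^-1` P).
Proof.
move=> hP hsurj /generic_polyP[F /peval_nonroot[x Fx] FP].
have [y yx] := hsurj x.
apply: (@generic_polyfun _ _ _ (fun y => peval F (h y)) y) => [||z /FP] //.
  exact: polyfun_meval.
by rewrite yx.
Qed.

Context {R : realType}.
Local Notation C := R[i].
Context {E : vectType C} {E' : vectType R}.

(** Real parameters are Zariski dense among complex ones.  If [F] does not
    vanish at [h x + 'i h y], then it does not vanish on the whole line through
    [h x] in direction [h y], hence not at all its points [h (x + m y)] with
    [m] a natural number.  The real and imaginary parts of [F \o h] are real
    polynomial functions. *)
Lemma generic_real (h : E' -> E) (P : set E) :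
    (forall a x y, h (a *: x + y) = a%:C *: h x + h y) ->
    (forall z, exists x y, z = h x + 'i *: h y) -> generic P ->
  generic (h @^-1` P).
Proof.
move=> hlin hspan /generic_polyP[F /peval_nonroot[z Fz] FP].
pose pf (g : E' -> C) := polyfun (fun x => complex.Re (g x)) /\ polyfun (fun x => complex.Im (g x)).
have pfF G : pf (fun x => peval G (h x)).
  move: G; apply: mpoly_ring_ind => [c|i|F1 F2 [r1 i1] [r2 i2]|F1 F2 [r1 i1] [r2 i2]].
  - by split; apply: (polyfun_ext (polyfunC _)) => x; rewrite pevalC.
  - have lin (f : C -> R) : (forall a u v, f (a%:C * u + v) = a * f u + f v) ->
        polyfun (fun x => f (peval 'X_i (h x))).
      move=> fl; have sc : scalar (fun x => f (peval 'X_i (h x))).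
        by move=> a x y; rewrite hlin !pevalX linearP /= fl.
      exact: (polyfun_linear (scalar_of sc)).
    split; apply: lin => a [u1 u2] [v1 v2] /=; ring.
  - by split; [apply: (polyfun_ext (polyfunD r1 r2))|apply: (polyfun_ext (polyfunD i1 i2))]
      => x; rewrite pevalD; case: (peval F1 _) => ? ?; case: (peval F2 _).
  - split; [apply: (polyfun_ext (polyfunB (polyfunM r1 r2) (polyfunM i1 i2)))
           |apply: (polyfun_ext (polyfunD (polyfunM r1 i2) (polyfunM i1 r2)))]
      => x; rewrite pevalM; case: (peval F1 _) => ? ?; case: (peval F2 _) => ? ? /=.
      by [].
    by [].
have [x Fx] : exists x, peval F (h x) != 0.
  have [x [y zE]] := hspan z.
  have [q qE] : exists q : {poly C}, forall t, q.[t] = peval F (h x + t *: h y).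
    move: (F); apply: mpoly_ring_ind => [c|i|F1 F2 [q1 e1] [q2 e2]|F1 F2 [q1 e1] [q2 e2]].
    - by exists c%:P => t; rewrite hornerC pevalC.
    - exists ((coord (vbasis {:E}) i (h x))%:P + (coord (vbasis {:E}) i (h y))%:P * 'X) => t.
      by rewrite pevalX linearD linearZ /= !(hornerD, hornerM, hornerC, hornerX) mulrC.
    - by exists (q1 + q2) => t; rewrite hornerD e1 e2 pevalD.
    - by exists (q1 * q2) => t; rewrite hornerM e1 e2 pevalM.
  have q0 : q != 0.
    by apply: contraNneq Fz => q0; rewrite zE -qE q0 horner0.
  have [m qm] := poly_nonroot q0; exists (m%:R *: y + x).
  by rewrite hlin addrC rmorph_nat -qE.
have [rF iF] := pfF F.
have [Rx|Rx] := eqVneq (complex.Re (peval F (h x))) 0.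
  apply: (generic_polyfun iF (x := x)) => [|y Iy].
    apply: contraNneq Fx => Ix; apply/eqP; move: Rx Ix.
    by case: (peval F (h x)) => ? ? /= -> ->.
  by apply: FP; apply: contraNneq Iy => ->.
apply: (generic_polyfun rF (x := x)) => // y Ry.
by apply: FP; apply: contraNneq Ry => ->.
Qed.

End Pullback.

Section RealParameters.
Context {R : realType} {k n : nat}.
Local Notation C := R[i].
Local Notation ER := {ffun 'I_k -> Sym R n}.
Local Notation EC := {ffun 'I_k -> Sym C n}.

Lemma cplxmx_tr (A : Sym R n) : (cplxmx A)^T = cplxmx A.
Proof. by rewrite /cplxmx map_trmx symmx_tr. Qed.

Definition cplx_diff (A : ER) : EC :=
  [ffun i => mksym (cplxmx (consecutive_diff A i))].

Lemma cplx_diffE A i : symmx (cplx_diff A i) = cplxmx (consecutive_diff A i).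
Proof. by rewrite ffunE mksymK // cplxmx_tr. Qed.

Lemma cplx_diff_linear a (A A' : ER) :
  cplx_diff (a *: A + A') = a%:C *: cplx_diff A + cplx_diff A'.
Proof.
apply/ffunP => i; apply: symmx_inj; rewrite !ffunE symmxP !mksymK ?cplxmx_tr //.
rewrite /cplxmx -map_mxZ -map_mxD -symmxP; congr (map_mx _ (symmx _)).
rewrite /consecutive_diff; case: insub => [j|]; rewrite !ffunE //.
by rewrite opprD scalerBr addrACA.
Qed.

Lemma cplx_diff_span (B : EC) : exists A A', B = cplx_diff A + 'i *: cplx_diff A'.
Proof.
have real_part (f : C -> R) : exists A : ER, forall i,
    symmx (consecutive_diff A i) = map_mx f (symmx (B i)).
  pose D i : Sym R n := mksym (map_mx f (symmx (B i))).
  exists [ffun j : 'I_k => \sum_(l < k | (j <= l)%N) D l] => i.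
  rewrite (@consecutive_diff_ext _ _ _ (fun j : 'I_k => \sum_(l < k | (j <= l)%N) D l)).
    by rewrite consecutive_diff_sum mksymK // map_trmx symmx_tr.
  by move=> j; rewrite ffunE.
have [A AE] := real_part (@complex.Re R); have [A' AE'] := real_part (@complex.Im R).
exists A, A'; apply/ffunP => i; apply: symmx_inj; rewrite !ffunE addrC symmxP addrC.
rewrite !mksymK ?cplxmx_tr // /cplxmx AE AE'; apply/matrixP => a b; rewrite !mxE.
exact: complexE.
Qed.

Lemma flag_objective_trace (A : ER) (B := consecutive_diff A) :
  flag_objective B = trace_form (cplx_diff A).
Proof. by apply/funext => P; apply: eq_bigr => i _; rewrite cplx_diffE. Qed.

Lemma critical_flag_objective (A : ER) (B := consecutive_diff A) :
  critical (@pFl C k n) (flag_objective B) = stationary (cplx_diff A).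
Proof. by rewrite flag_objective_trace critical_pFl. Qed.

(** A critical frame spans a stationary flag; there are finitely many of the
    latter, and each has finitely many frames. *)
Lemma finite_critical_stiefel (A : ER) : (k <= n)%N ->
    finite_set (stationary (cplx_diff A)) ->
  finite_set (critical (@stiefel C k n) (stiefel_objective A)).
Proof.
move=> kn fin.
apply: (@sub_finite_set _ _ (\bigcup_(P in stationary (cplx_diff A))
    [set Z : 'M[C]_(n, k) | forall i, symmx (P i) = frame_proj Z i.+1])).
  move=> Z ZA.
  have [ZZ ZE] := critical_stiefel (fun i => cplxmx_tr (A i)) ZA.
  pose P : EC := [ffun i => mksym (frame_proj Z (val i).+1)].
  have PE i : symmx (P i) = frame_proj Z i.+1 by rewrite ffunE mksymK ?frame_proj_tr.
  exists P => //; apply: frame_stationary kn ZZ _ ZE PE => j.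
  under eq_bigr do rewrite cplx_diffE /cplxmx.
  rewrite -raddf_sum; congr map_mx.
  by rewrite -[in RHS]sum_consecutive_diff symmx_sum.
by apply: bigcup_finite => // P _; apply: finite_frames.
Qed.

End RealParameters.

Lemma trace_form_LO (C : numClosedFieldType) k n d :
    generic [set B : {ffun 'I_k -> Sym C n} | stationary B #= `I_d] ->
  LO_degree (@pFl C k n) d.
Proof.
move=> gen; pose E : vectType C := {ffun 'I_k -> Sym C n}.
pose h (l : 'Hom(E, C^o)) : E := gradient l.
apply: generic_sub (generic_pullback (h := h) _ _ gen) => [l /= | i | B].
- have sc : scalar (l : E -> C) by move=> c x y; rewrite linearP.
  rewrite -critical_pFl /h (_ : trace_form (gradient l) = l) //.
  by apply/funext => P; apply: (trace_form_gradient (scalar_of sc)).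
- apply: polyfun_entries => j a b.
  have sc : scalar (fun l : 'Hom(E, C^o) => l (sym_unit j a b)).
    by move=> c l l'; rewrite add_lfunE scale_lfunE.
  apply: (polyfun_ext (polyfun_linear (scalar_of sc))) => l.
  by rewrite gradientE.
exists (linfun (trace_form B : E -> C^o)).
rewrite /h -[RHS]gradient_trace_form; congr gradient; apply/funext => P.
by rewrite lfunE.
Qed.

Theorem corollary4p4 (R : realType) (k n : nat)
    (k_bounds : (1 <= k <= n)%N) :
  exists d : nat,
    LO_degree (@pFl R[i] k n) d /\
    generic [set A : {ffun 'I_k -> Sym R n} |
      let B := consecutive_diff A in
      [/\ critical (@pFl R[i] k n) (flag_objective B) #= `I_d,
          finite_set (critical (@pFl R[i] k n) (flag_objective B)) &
          finite_set (critical (@stiefel R[i] k n) (stiefel_objective A))]].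
Proof.
have /andP[_ kn] := k_bounds.
have [d gen] := stationary_generic_card (C := R[i]) kn.
exists d; split; first exact: trace_form_LO.
have := generic_real cplx_diff_linear cplx_diff_span gen.
apply: generic_sub => A /= cardA.
have fin : finite_set (stationary (cplx_diff A)) by exists d.
by rewrite critical_flag_objective; split=> //; apply: finite_critical_stiefel.
Qed.
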